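(* Assume that $0\le\rho_x,\rho_y<1$, $-1\le\rho_{xy}\le 1$ and $$2\rho_x^2(1+2|\rho_{xy}|)<1,\qquad 2\rho_y^2(1+2|\rho_{xy}|)<1,\qquad 2\rho_x\rho_y(3\rho_{xy}^2+2|\rho_{xy}|+1)<1 .$$ Then the implicit Milstein finite difference scheme (defined in the context) is unconditionally stable in the mean-square sense: for all $h_x,h_y,k>0$ (without any restriction between them) and all $(\xi,\eta)\in[-\pi/h_x,\pi/h_x]\times[-\pi/h_y,\pi/h_y]$ with $(\xi,\eta)\ne(0,0)$, $$\lim_{n\to\infty}\mathbb{E}\big[|X_n(\xi,\eta)|^2\big]=0.$$
   Context: Let $\mu_x,\mu_y\in\mathbb{R}$ and let $i_0,j_0\in\mathbb{Z}$. Grid functions are $V=(V_{i,j})_{i,j\in\mathbb{Z}}$ on a grid with spacings $h_x,h_y>0$, and $k>0$ is the time step. **Difference operators.** $(D_xV)_{i,j}=V_{i+1,j}-V_{i-1,j}$, $(D_yV)_{i,j}=V_{i,j+1}-V_{i,j-1}$, $(D_{xx}V)_{i,j}=V_{i+1,j}-2V_{i,j}+V_{i-1,j}$, $(D_{yy}V)_{i,j}=V_{i,j+1}-2V_{i,j}+V_{i,j-1}$, $(D_{xy}V)_{i,j}=V_{i+1,j+1}-V_{i-1,j+1}-V_{i+1,j-1}+V_{i-1,j-1}$; $D_x^2=D_xD_x$, $D_y^2=D_yD_y$. **Noise.** $\widetilde Z_{n,y}=\rho_{xy}Z_{n,x}+\sqrt{1-\rho_{xy}^2}\,Z_{n,y}$,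 where $Z_{n,x},Z_{n,y}$, $n\ge0$, are independent $N(0,1)$ random variables. **Implicit Milstein finite difference scheme.** $V^0_{i,j}=h_x^{-1}h_y^{-1}$ if $(i,j)=(i_0,j_0)$, $V^0_{i,j}=0$ otherwise, and for $n\ge0$ $$\begin{aligned}&\Big(I+\tfrac{\mu_xk}{2h_x}D_x+\tfrac{\mu_yk}{2h_y}D_y-\tfrac{k}{2h_x^2}D_{xx}-\tfrac{k}{2h_y^2}D_{yy}\Big)V^{n+1}\\&=\Big(I-\tfrac{\sqrt{\rho_xk}Z_{n,x}}{2h_x}D_x-\tfrac{\sqrt{\rho_yk}\widetilde Z_{n,y}}{2h_y}D_y+\tfrac{\rho_xk(Z_{n,x}^2-1)}{8h_x^2}D_x^2+\tfrac{\rho_yk(\widetilde Z_{n,y}^2-1)}{8h_y^2}D_y^2+\tfrac{\sqrt{\rho_x\rho_y}kZ_{n,x}\widetilde Z_{n,y}}{4h_xh_y}D_{xy}\Big)V^n,\end{aligned}$$ where $V^{n+1}$ is the solution in $\ell^2(\mathbb{Z}^2)$. **Fourier coefficients.** $X_n(\xi,\eta)=\widetilde V^n(\xi,\eta)$ denotes the discrete Fourier transform of $V^n$, i.e. $$V^n_{i,j}=\frac1{4\pi^2}\int_{-\pi/h_y}^{\pi/h_y}\int_{-\pi/h_x}^{\pi/h_x}X_n(\xi,\eta)\,e^{\mathrm{i}((i-i_0)\xi h_x+(j-j_0)\eta h_y)}\,\mathrm{d}\xi\,\mathrm{d}\eta,\qquad X_0\equiv1$$ ($\mathrm{i}$ outside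 the bracket is the imaginary unit). Inserting this into the scheme gives $X_{n+1}(\xi,\eta)=C_n(\xi,\eta)X_n(\xi,\eta)$ with an explicit random trigonometric factor $C_n$, so $X_n$ is defined pointwise in $(\xi,\eta)$. *)

(* Defs.v *)
From HB Require Import structures.
From mathcomp Require Import all_boot all_order all_algebra.
From mathcomp Require Import complex.
From mathcomp Require Import all_classical all_reals all_analysis.

Set Implicit Arguments.
Unset Strict Implicit.
Unset Printing Implicit Defensive.

Import Order.TTheory GRing.Theory Num.Theory numFieldNormedType.Exports.

Local Open Scope classical_set_scope.
Local Open Scope ring_scope.
Local Open Scope complex_scope.

Section Grid.
Context {R : realType}.

Definition grid := int -> int -> R.

Implicit Types V : grid.

Definition Dx V : grid := fun i j => V (i + 1) j - V (i - 1) j.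
Definition Dy V : grid := fun i j => V i (j + 1) - V i (j - 1).
Definition Dxx V : grid := fun i j => V (i + 1) j - 2 * V i j + V (i - 1) j.
Definition Dyy V : grid := fun i j => V i (j + 1) - 2 * V i j + V i (j - 1).
Definition Dxy V : grid := fun i j =>
  V (i + 1) (j + 1) - V (i - 1) (j + 1) - V (i + 1) (j - 1)
  + V (i - 1) (j - 1).

Definition square_summable V : Prop :=
  summable [set: int * int] (fun p => ((V p.1 p.2) ^+ 2)%:E).

Definition initial_grid (hx hy : R) (i0 j0 : int) : grid := fun i j =>
  if (i == i0) && (j == j0) then hx^-1 * hy^-1 else 0.

Definition implicit_operator (mux muy hx hy k : R) V : grid := fun i j =>
  V i j + mux * k / (2 * hx) * Dx V i j + muy * k / (2 * hy) * Dy V i j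
  - k / (2 * hx ^+ 2) * Dxx V i j - k / (2 * hy ^+ 2) * Dyy V i j.

(* [zx] and [zty] are the values taken by Z_{n,x} and \tilde Z_{n,y} *)
Definition explicit_operator (rhox rhoy hx hy k zx zty : R) V : grid :=
  fun i j =>
  V i j
  - Num.sqrt (rhox * k) * zx / (2 * hx) * Dx V i j
  - Num.sqrt (rhoy * k) * zty / (2 * hy) * Dy V i j
  + rhox * k * (zx ^+ 2 - 1) / (8 * hx ^+ 2) * Dx (Dx V) i j
  + rhoy * k * (zty ^+ 2 - 1) / (8 * hy ^+ 2) * Dy (Dy V) i j
  + Num.sqrt (rhox * rhoy) * k * zx * zty / (4 * hx * hy) * Dxy V i j.

Definition correlated (rhoxy zx zy : R) : R :=
  rhoxy * zx + Num.sqrt (1 - rhoxy ^+ 2) * zy.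

(* One trajectory of the scheme, driven by the noise values
   [zx n] and [zy n]. *)
Definition milstein_scheme (mux muy rhox rhoy rhoxy hx hy k : R)
    (i0 j0 : int) (zx zy : nat -> R) (V : nat -> grid) : Prop :=
  V 0%N = initial_grid hx hy i0 j0 /\
  forall n : nat,
    square_summable (V n.+1) /\
    implicit_operator mux muy hx hy k (V n.+1) =
    explicit_operator rhox rhoy hx hy k (zx n)
      (correlated rhoxy (zx n) (zy n)) (V n).

Definition cexpi (t : R) : R[i] := cos t +i* sin t.

Definition cintegral (a b : R) (f : R -> R[i]) : R[i] :=
  (\int[lebesgue_measure]_(t in `[a, b]) complex.Re (f t)) +i*
  (\int[lebesgue_measure]_(t in `[a, b]) complex.Im (f t)).

Definition freq_box (hx hy : R) : set (R * R) :=
  `[- (pi / hx), pi / hx] `*` `[- (pi / hy), pi / hy].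

(* [X] is the discrete Fourier transform of [V], centred at [(i0, j0)].  The
   inversion formula determines [X] only up to a Lebesgue-null set; continuity
   singles out the representative for which pointwise values make sense. *)
Definition is_dft (hx hy : R) (i0 j0 : int) V (X : R -> R -> R[i]) : Prop :=
  {within freq_box hx hy,
    continuous (fun p : R * R => complex.Re (X p.1 p.2))} /\
  {within freq_box hx hy,
    continuous (fun p : R * R => complex.Im (X p.1 p.2))} /\
  forall i j : int,
    (V i j)%:C = ((4 * pi ^+ 2)^-1)%:C *
      cintegral (- (pi / hy)) (pi / hy) (fun eta =>
        cintegral (- (pi / hx)) (pi / hx) (fun xi =>
          X xi eta *
          cexpi ((i - i0)%:~R * xi * hx + (j - j0)%:~R * eta * hy))).

End Grid.

Arguments grid R : clear implicits.

Section Noise.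
Context {d : measure_display} {T : measurableType d} {R : realType}.
Variable P : probability T R.

Definition mutually_independent (I : choiceType)
    (X : I -> {RV P >-> R}) : Prop :=
  forall (s : seq I) (A : I -> set R), uniq s ->
    (forall i, i \in s -> measurable (A i)) ->
    P (\bigcap_(i in [set` s]) (X i @^-1` A i)) =
    (\prod_(i <- s) P (X i @^-1` A i))%E.

Definition standard_normal (Z : {RV P >-> R}) : Prop :=
  forall A : set R, measurable A -> distribution P Z A = normal_prob 0 1 A.

(* All the [Zx m] and [Zy n] together form one independent family. *)
Definition gaussian_noise (Zx Zy : nat -> {RV P >-> R}) : Prop :=
  (forall n, standard_normal (Zx n)) /\
  (forall n, standard_normal (Zy n)) /\
  mutually_independent
    (fun m : nat + nat => match m with inl n => Zx n | inr n => Zy n end).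

End Noise.

(* Main.v *)
(* On the Fourier side one step of the scheme multiplies [X_n (xi, eta)] by
   [B / A], where [A] and [B] are the symbols of the implicit and explicit
   operators.  This is read off the grid equation because a continuous function
   on the frequency box is determined by its Fourier coefficients.  With
   [p = sqrt (rho_x k) / h_x * sin (xi h_x)],
   [q = sqrt (rho_y k) / h_y * sin (eta h_y)] and
   [W = p Z_{n,x} + q \tilde Z_{n,y}] one finds
   [B = 1 - i W - (W^2 - p^2 - q^2) / 2], so the noise being independent,
   [E |X_n|^2 = (E |B|^2 / |A|^2)^n], and the Gaussian moments give, with
   [s = p^2 + q^2],
   [E |B|^2 = 1 + s + s^2 / 2 + 2 s rho_xy p q + 3 rho_xy^2 p^2 q^2].
   If [al] and [be] are the diffusive parts of [Re A = 1 + al + be], then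
   [p^2 <= 2 rho_x al] and [q^2 <= 2 rho_y be], and the three hypotheses bound
   [E |B|^2] strictly by [(1 + al + be)^2 <= |A|^2]. *)
From HB Require Import structures.
Require Import Defs.
From mathcomp Require Import all_boot all_order all_algebra.
From mathcomp Require Import complex.
From mathcomp Require Import all_classical all_reals all_analysis.
From mathcomp Require Import measurable_realfun ring lra.

Import Order.TTheory GRing.Theory Num.Theory numFieldNormedType.Exports.

Local Open Scope classical_set_scope.
Local Open Scope ring_scope.
Local Open Scope complex_scope.

(** * Gaussian moments *)

(** The inversion formula gives [X_n] only through integrals over the box, so the one-step relation
    at a single frequency is a uniqueness statement about functions that are merely continuous on a
    closed box, with no smoothness or periodicity to make a Fourier series converge. Lebesgue's
    peaking argument, applied in one variable at a time, needs only continuity. The exact [n]-th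
    power requires integrating a product of functions of independent variables, while independence
    is given on events. The past product times the indicator of a future event is therefore taken as
    the density of a new measure; its image under the next noise pair is a constant times a product
    of Gaussian laws, and Tonelli applies. Integrands in the probabilistic part are nonnegative, so
    integrability is an issue only for monomials against the Gaussian density, where a wider
    Gaussian dominates. *)

Section density.
Local Open Scope ereal_scope.
Import HBNNSimple.
Context d (T : measurableType d) (R : realType).
Variables (mu nu : {measure set T -> \bar R}) (D : T -> R).
Hypothesis D0 : forall x, (0 <= D x)%R.
Hypothesis mD : measurable_fun setT D.
Let mDE : measurable_fun setT (EFin \o D).
Proof. exact/measurable_EFinP. Qed.

Hypothesis nuE : forall A, measurable A -> nu A = \int[mu]_(x in A) (D x)%:E.

Let integral_density_nnsfun (h : {nnsfun T >-> R}) :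
  \int[nu]_x (h x)%:E = \int[mu]_x ((h x)%:E * (D x)%:E).
Proof.
under [LHS]eq_integral do rewrite fimfunE -fsumEFin//.
rewrite [LHS]ge0_integral_fsum//; last 2 first.
  - by move=> r; exact/measurable_EFinP/measurableT_comp.
  - by move=> n x _; rewrite EFinM nnfun_muleindic_ge0.
under [RHS]eq_integral.
  move=> x xD; rewrite fimfunE -fsumEFin// ge0_mule_fsuml; last first.
    by move=> r; rewrite EFinM nnfun_muleindic_ge0.
  over.
rewrite [RHS]ge0_integral_fsum//; last 2 first.
  - move=> r; apply: emeasurable_funM => //; apply/measurable_EFinP.
    by do 2 apply/measurableT_comp => //.
  - by move=> n x _; rewrite mule_ge0 ?(lee_fin _ (D x))// EFinM nnfun_muleindic_ge0.
apply: eq_fsbigr => r _.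
have [r0|r0] := leP 0%R r; last first.
  rewrite preimage_nnfun0// indic0.
  by rewrite !integral0_eq// => x _; rewrite /= ?mulr0 ?mul0e.
under [RHS]eq_integral do rewrite EFinM -muleA.
rewrite [RHS]ge0_integralZl//; last 2 first.
  - apply: emeasurable_funM => //; apply/measurable_EFinP.
    exact/measurable_indic.
  - by move=> x _; rewrite mule_ge0 ?lee_fin.
under [LHS]eq_integral do rewrite EFinM.
rewrite [LHS]ge0_integralZl//; last first.
  by apply/measurable_EFinP; exact/measurable_indic.
congr (_ * _).
rewrite integral_indic// setIT nuE//.
rewrite integral_mkcond; apply: eq_integral => x _.
rewrite patchE indicE; case: ifPn => _.
  by rewrite mul1e.
by rewrite mul0e.
Qed.

(** Simple functions, then monotone convergence. Knowing [nu] on measurable sets is enough, so the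
    lemma serves both the normal law over Lebesgue measure and reweightings of [P]. *)
Lemma ge0_integral_density (f : T -> \bar R) : measurable_fun setT f ->
  (forall x, 0 <= f x) -> \int[nu]_x f x = \int[mu]_x (f x * (D x)%:E).
Proof.
move=> mf f0; pose f_ := nnsfun_approx measurableT mf.
transitivity (limn (fun n => \int[nu]_x (f_ n x)%:E)).
  rewrite -monotone_convergence//=.
  - apply: eq_integral => x _; apply/esym/cvg_lim => //=.
    exact: cvg_nnsfun_approx.
  - by move=> n; apply: measurableT_comp => //; exact: measurable_funTS.
  - by move=> n x _; rewrite lee_fin.
  - by move=> x _ a b ab; rewrite lee_fin//; exact/lefP/nd_nnsfun_approx.
rewrite [RHS](_ : _ = limn (fun n => \int[mu]_x ((f_ n x)%:E * (D x)%:E))).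
  by congr (limn _); apply/funext => n /=; rewrite integral_density_nnsfun.
rewrite -monotone_convergence//=.
- apply: eq_integral => x _; apply/esym/cvg_lim => //.
  by apply: cvgeZr => //; exact: cvg_nnsfun_approx.
- by move=> n; apply: emeasurable_funM => //; exact/measurable_EFinP/measurable_funTS.
- by move=> n x _; rewrite mule_ge0 ?lee_fin.
- by move=> x _ a b ab; rewrite lee_wpmul2r ?lee_fin//; exact/lefP/nd_nnsfun_approx.
Qed.

End density.

(** Dominated convergence: at each point the truncations are eventually constant. It reduces
    integrals over the line to compact intervals, where the fundamental theorem of calculus
    applies. *)
Lemma cvg_integral_symitv (R : realType) (f : R -> R) :
  lebesgue_measure.-integrable [set: R] (EFin \o f) ->
  (\int[lebesgue_measure]_(x in `[(- n%:R)%R, n%:R%R]) (f x)%:E)%E @[n --> \oo]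
    --> (\int[lebesgue_measure]_x (f x)%:E)%E.
Proof.
move=> intf.
have mf := measurable_int _ intf.
under eq_fun do rewrite integral_mkcond.
have mI (n : nat) : measurable_fun [set: R] ((EFin \o f) \_ `[- n%:R, n%:R]).
  by apply/measurable_restrict => //; rewrite setTI; exact: measurable_funS mf.
apply: (dominated_cvg (measurableT : measurable [set: measurableTypeR R])
  (f_ := fun n => (EFin \o f) \_ `[- n%:R, n%:R])
  (f := EFin \o f) (g := fun x => `|f x|%:E)) => //=.
- move=> x _; apply: cvg_near_cst; near=> n.
  rewrite patchE mem_set//= in_itv/= -ler_norml.
  near: n; exact: nbhs_infty_ger.
- by move/integrable_abse : intf.
- move=> n x _; rewrite patchE; case: ifPn => //= _.
  by rewrite normr0 lee_fin.
Unshelve. all: by end_near. Qed.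

(** On [[-n, n]] the integral is [F n - F (-n)], and the decay hypothesis bounds each of the two
    boundary terms by [C / n]. *)
Lemma integral_derivative_eq0 (R : realType) (f F : R -> R) (C : R) :
  continuous f -> lebesgue_measure.-integrable [set: R] (EFin \o f) ->
  (forall x : R, is_derive x 1 F (f x)) ->
  (forall x, `|F x| * `|x| <= C) ->
  (\int[lebesgue_measure]_x (f x)%:E)%E = 0%E.
Proof.
move=> cf intf dF FC.
rewrite -(cvg_lim _ (cvg_integral_symitv _ _ intf))//; apply/cvg_lim => //.
have cF : continuous F by move=> x; exact/differentiable_continuous/derivable1_diffP.
have FTC (n : nat) : (0 < n)%N -> (\int[lebesgue_measure]_(x in `[(- n%:R)%R, n%:R%R]) (f x)%:E)%E =
    (F n%:R - F (- n%:R))%:E.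
  move=> n0; rewrite (@continuous_FTC2 _ f F) ?EFinB//.
  - by rewrite gtrN// ltr0n.
  - exact: continuous_subspaceT.
  - split.
    + by move=> x _; apply: ex_derive.
    + exact/cvg_at_right_filter/cF.
    + exact/cvg_at_left_filter/cF.
  - by move=> x _; rewrite derive1E derive_val.
apply: (@cvg_trans _ ((F n%:R - F (- n%:R))%:E @[n --> \oo])).
  apply: near_eq_cvg; near=> n; rewrite FTC//.
  near: n; exact: nbhs_infty_gt.
apply: cvg_EFin; first exact: nearW.
apply/norm_cvg0P.
have : 2 * C * (n.+1%:R)^-1 @[n --> \oo] --> (0 : R).
  rewrite -[X in _ --> X](mulr0 (2 * C)).
  by apply: cvgMr; exact: cvg_harmonic.
rewrite (cvg_shiftS (fun n => 2 * C / n%:R)) => Cn.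
apply: (squeeze_cvgr _ (cvg_cst 0) Cn).
near=> n; rewrite normr_ge0/=.
have n0 : 0 < n%:R :> R by rewrite ltr0n; near: n; exact: nbhs_infty_gt.
rewrite ler_pdivlMr//.
have := FC n%:R; have := FC (- n%:R); rewrite normrN (gtr0_norm n0).
have := ler_normB (F n%:R) (F (- n%:R)).
nra.
Unshelve. all: by end_near. Qed.

Section normal_moments.
Variable R : realType.
Local Notation mu := (@lebesgue_measure R).
Local Notation phi := (normal_pdf 0 1 : R -> R).

Lemma normal_pdf01E (x : R) : phi x = normal_peak 1 * expR (- (x ^+ 2 / 2)).
Proof.
rewrite normal_pdfE ?oner_neq0// /normal_fun subr0 expr1n.
by rewrite mulNr -mulr_natr mul1r.
Qed.

Lemma is_derive_normal_pdf01 (x : R) : is_derive x 1 phi (- (x * phi x)).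
Proof.
rewrite (_ : phi = fun x => normal_peak 1 * expR (- (x ^+ 2 / 2))); last first.
  by apply/funext => y; rewrite normal_pdf01E.
apply: is_derive_eq.
rewrite /GRing.scale/=; by field.
Qed.

(** Square [1 + y / 2 <= expR (y / 2)]. *)
Lemma sqr_le_4expR (y : R) : 0 <= y -> y ^+ 2 <= 4 * expR y.
Proof.
move=> y0; have h := expR_ge1Dx (y / 2).
rewrite [y in expR y](_ : y = y / 2 + y / 2); last by field.
rewrite expRD; nra.
Qed.

(** A Gaussian of variance 2 absorbs the factor [1 + x^4]. This majorant is both integrable and
    bounded, so it gives the integrability of the moments and the decay of the boundary terms. *)
Lemma normal_pdf01_decay : exists K : R, 0 <= K /\
  forall x : R, (1 + x ^+ 4) * phi x <= K * normal_pdf 0 (Num.sqrt 2) x.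
Proof.
set p1 := @normal_peak R 1; set p2 := @normal_peak R (Num.sqrt 2).
have p10 : 0 < p1 by apply: normal_peak_gt0; rewrite oner_neq0.
have s2 : Num.sqrt 2 != 0 :> R by rewrite gt_eqF// sqrtr_gt0.
have p20 : 0 < p2 by exact: normal_peak_gt0.
(* With [y = x^2 / 4], passing to variance 2 frees a factor [expR (- y)], and [(1 + 16 y^2) expR (-
   y) <= 1 + 16 * 4 = 65]; [p1 / p2] exchanges the normalising constants. *)
exists (p1 * 65 / p2); split; first by rewrite !mulr_ge0// ?invr_ge0// ltW.
move=> x; rewrite normal_pdf01E normal_pdfE// /normal_fun subr0.
rewrite sqr_sqrtr// -/p1 -/p2 [leRHS]mulrA divfK ?gt_eqF//.
rewrite [2 *+ 2](_ : _ = 4); last by rewrite -mulr_natr -natrM.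
set y := x ^+ 2 / 4.
have y0 : 0 <= y by rewrite divr_ge0// sqr_ge0.
rewrite (_ : - (x ^+ 2 / 2) = - y + - y); last by rewrite /y; field.
rewrite (_ : - x ^+ 2 / 4 = - y); last by rewrite /y; field.
rewrite (_ : x ^+ 4 = 16 * y ^+ 2); last by rewrite /y; field.
rewrite expRD; have := sqr_le_4expR y y0.
have e0 := expR_gt0 (- y).
have e1 : expR y * expR (- y) = 1 by rewrite -expRD subrr expR0.
have e2 : expR (- y) <= 1 by rewrite -[leRHS]expR0 ler_expR oppr_le0.
move=> h.
have {}h : y ^+ 2 * expR (- y) <= 4 by have := ler_wpM2r (ltW e0) h; rewrite -[leRHS]mulrA e1 mulr1.
have h2 : (1 + 16 * y ^+ 2) * expR (- y) <= 65 by lra.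
have := ler_wpM2l (ltW p10) (ler_wpM2r (ltW e0) h2); lra.
Qed.

Let normX_le_1DX4 (x : R) (j : nat) : (j <= 4)%N -> `|x| ^+ j <= 1 + x ^+ 4.
Proof.
move=> j4; rewrite -(ger0_norm (exprn_even_ge0 x (isT : ~~ odd 4))) normrX.
have [x1|/ltW x1] := leP `|x| 1.
  by rewrite (@le_trans _ _ 1) ?exprn_ile1// lerDl exprn_ge0.
by rewrite (@le_trans _ _ (`|x| ^+ 4)) ?lerDr// ler_weXn2l.
Qed.

Lemma integrable_monomial_normal_pdf (j : nat) : (j <= 4)%N ->
  mu.-integrable [set: R] (fun x => (x ^+ j * phi x)%:E).
Proof.
move=> j4; have [K [K0 HK]] := normal_pdf01_decay.
have mphi : measurable_fun [set: R] phi by exact: measurable_normal_pdf.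
apply: (le_integrable (measurableT : measurable [set: measurableTypeR R])
  (g := fun x => (K * normal_pdf 0 (Num.sqrt 2) x)%:E)) => //.
- by apply/measurable_EFinP; apply: measurable_funM => //; exact: exprn_measurable.
- move=> x _ /=; rewrite lee_fin normrM.
  have p0 := normal_pdf_ge0 0 1 x.
  rewrite (ger0_norm p0) normrX [leRHS]ger0_norm; last first.
    by rewrite mulr_ge0// normal_pdf_ge0.
  apply: le_trans (HK x); apply: ler_wpM2r => //.
  by apply: normX_le_1DX4.
- exact: (integrableZl (measurableT : measurable [set: measurableTypeR R]) K
    (integrable_normal_pdf _ _)).
Qed.

(** Integration by parts: the difference of the two integrands is the derivative of [- x^j phi]. At
    [j = 0] the truncated predecessor is harmless because of the factor [0]; [j <= 3] keeps the
    degree within the decay bound. *)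
Lemma normal_moment_rec (j : nat) : (j <= 3)%N ->
  (\int[mu]_x (x ^+ j.+1 * phi x) = j%:R * \int[mu]_x (x ^+ j.-1 * phi x))%R.
Proof.
move=> j3; have [K [K0 HK]] := normal_pdf01_decay.
pose f x := x ^+ j.+1 * phi x - j%:R * (x ^+ j.-1 * phi x).
have i1 : mu.-integrable [set: R] (fun x => (x ^+ j.+1 * phi x)%:E).
  exact: integrable_monomial_normal_pdf.
have i2 : mu.-integrable [set: R] (fun x => (x ^+ j.-1 * phi x)%:E).
  apply: integrable_monomial_normal_pdf.
  by rewrite (leq_trans (leq_pred _))// (leq_trans j3).
have i3 : mu.-integrable [set: R] (fun x => (j%:R * (x ^+ j.-1 * phi x))%:E).
  exact: (integrableZl (measurableT : measurable [set: measurableTypeR R]) j%:R i2).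
have cphi : continuous phi by apply: continuous_normal_pdf; rewrite oner_neq0.
have intf : mu.-integrable [set: R] (EFin \o f).
  exact: (integrableB (measurableT : measurable [set: measurableTypeR R]) i1 i3).
have s2 : Num.sqrt 2 != 0 :> R by rewrite gt_eqF// sqrtr_gt0.
(* The boundary quantity is [|x|^(j+1) phi x], at most [K] times the density of variance 2, whose
   maximum is its peak. *)
have := @integral_derivative_eq0 R f (fun x => - (x ^+ j * phi x))
  (K * normal_peak (Num.sqrt 2)) _ intf.
move=> H; apply/eqP; rewrite -subr_eq0 -RintegralZl// -RintegralB//.
suff -> : (\int[mu]_x f x = 0)%R by [].
rewrite /Rintegral; suff -> : (\int[mu]_x (f x)%:E = 0)%E by [].
apply: H.
- move=> x; rewrite /f; apply: cvgB; [|apply: cvgM; first exact: cvg_cst];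
    apply: cvgM; try exact: exprn_continuous; exact: cphi.
- move=> x; have hphi := is_derive_normal_pdf01 x.
  have hX : is_derive x 1 ((@id R) ^+ j) ((j%:R * x ^+ j.-1) *: (1 : R)) by exact: is_deriveX.
  have := is_deriveN (is_deriveM hX hphi).
  rewrite (_ : - ((@id R) ^+ j * phi) = fun y => - (y ^+ j * phi y)); last first.
    by apply/funext => y; rewrite /= !fctE.
  move/is_derive_eq; apply; rewrite /f /GRing.scale/= !fctE exprS. ring.
- move=> x; rewrite normrN normrM.
  have p0 := normal_pdf_ge0 0 1 x.
  rewrite (ger0_norm p0) mulrAC normrX -exprSr.
  apply: le_trans (ler_wpM2l K0 (normal_pdf_ub 0 x s2)).
  apply: le_trans (HK x); apply: ler_wpM2r => //.
  by apply: normX_le_1DX4.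
Qed.

End normal_moments.

Section normal_poly.
Variable R : realType.
Local Notation mu := (@lebesgue_measure R).
Local Notation phi := (normal_pdf 0 1 : R -> R).
Local Notation gamma := (@normal_prob R 0 1).

Let m (j : nat) := (\int[mu]_x (x ^+ j * phi x))%R.

Let m0 : m 0 = 1.
Proof.
rewrite /m /Rintegral.
rewrite (_ : (\int[mu]_x (x ^+ 0 * phi x)%:E = 1)%E)//.
rewrite -(integral_normal_pdf 0 (1 : R)).
by apply: eq_integral => x _; rewrite expr0 mul1r.
Qed.

Let integrable_scaled_monomial (a : R) (j : nat) : (j <= 4)%N ->
  mu.-integrable [set: R] (fun x => (a * (x ^+ j * phi x))%:E).
Proof.
move=> /(integrable_monomial_normal_pdf R) ij.
exact: (integrableZl (measurableT : measurable [set: measurableTypeR R]) a ij).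
Qed.

Let integral_scaled_monomial (a : R) (j : nat) : (j <= 4)%N ->
  (\int[mu]_x (a * (x ^+ j * phi x))%:E)%E = (a * m j)%:E.
Proof.
move=> j4; have h := integrable_scaled_monomial a j j4.
rewrite -[LHS]fineK; last by apply: integrable_fin_num.
congr EFin; apply: RintegralZl => //.
exact: integrable_monomial_normal_pdf.
Qed.

(** The moments of order 0 to 4 are 1, 0, 1, 0, 3. Nonnegativity of [p] gives the passage to
    Lebesgue measure, after which the monomials are integrated separately. *)
Lemma integral_normal_poly4 (a0 a1 a2 a3 a4 : R) :
  let p x := a0 + a1 * x + a2 * x ^+ 2 + a3 * x ^+ 3 + a4 * x ^+ 4 in
  (forall x, 0 <= p x) ->
  (\int[gamma]_x (p x)%:E)%E = (a0 + a2 + 3 * a4)%:E.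
Proof.
move=> p p0.
have mp : measurable_fun [set: R] p.
  rewrite /p; do ?[apply: measurable_funD => //]; apply: measurable_funM => //;
    exact: exprn_measurable.
rewrite (@ge0_integral_density _ _ _ mu gamma phi (normal_pdf_ge0 0 1)
  (measurable_normal_pdf 0 1) (fun _ _ => erefl)); last 2 first.
- exact/measurable_EFinP.
- by move=> x; rewrite lee_fin.
pose t j a x := a * (x ^+ j * phi x).
have it j a : (j <= 4)%N -> mu.-integrable [set: R] (fun x => (t j a x)%:E).
  exact: integrable_scaled_monomial.
transitivity (\int[mu]_x ((t 0%N a0 x)%:E + (t 1%N a1 x)%:E + (t 2%N a2 x)%:E
    + (t 3%N a3 x)%:E + (t 4%N a4 x)%:E))%E.
  apply: eq_integral => x _; rewrite -EFinM -!EFinD; congr EFin.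
  by rewrite /p /t; ring.
have h1 := integrableD (measurableT : measurable [set: measurableTypeR R])
  (it 0%N a0 isT) (it 1%N a1 isT).
have h2 := integrableD (measurableT : measurable [set: measurableTypeR R])
  h1 (it 2%N a2 isT).
have h3 := integrableD (measurableT : measurable [set: measurableTypeR R])
  h2 (it 3%N a3 isT).
rewrite integralD ?it// integralD ?it// integralD ?it// integralD ?it//.
rewrite !integral_scaled_monomial// -!EFinD; congr EFin.
have m1 : m 1 = 0 by rewrite /m (@normal_moment_rec R 0)// mul0r.
have m2 : m 2 = 1 by rewrite /m (@normal_moment_rec R 1)// mul1r -[RHS]m0.
have m3 : m 3 = 0 by rewrite /m (@normal_moment_rec R 2)// -/(m 1) m1 mulr0.
have m4 : m 4 = 3 by rewrite /m (@normal_moment_rec R 3)// -/(m 2) m2 mulr1.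
by rewrite m0 m1 m2 m3 m4; ring.
Qed.

(** [U = c x + d y] is centred Gaussian of variance [v = c^2 + d^2], so [E U^2 = v] and
    [E U^4 = 3 v^2]. The proof obtains this by two one-dimensional integrations instead of
    identifying the law of [U]. *)
Lemma integral_normal_symbol (c d e r : R) : 0 <= r ->
  (\int[gamma]_x \int[gamma]_y
    (r * ((c * x + d * y) ^+ 2 + (e - (c * x + d * y) ^+ 2 / 2) ^+ 2))%:E)%E =
  (r * ((1 - e) * (c ^+ 2 + d ^+ 2) + e ^+ 2
        + 3 / 4 * (c ^+ 2 + d ^+ 2) ^+ 2))%:E.
Proof.
move=> r0.
(* The average over [y] at fixed [u = c x]; the quartic part is
   [E (u + d y)^4 = u^4 + 6 u^2 d^2 + 3 d^4]. *)
pose inner u := r * ((1 - e) * (u ^+ 2 + d ^+ 2) + e ^+ 2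
  + (u ^+ 4 + 6 * u ^+ 2 * d ^+ 2 + 3 * d ^+ 4) / 4).
have f0 u : 0 <= r * (u ^+ 2 + (e - u ^+ 2 / 2) ^+ 2).
  by rewrite mulr_ge0// addr_ge0// sqr_ge0.
have innerE x : (\int[gamma]_y
    (r * ((c * x + d * y) ^+ 2 + (e - (c * x + d * y) ^+ 2 / 2) ^+ 2))%:E)%E
    = (inner (c * x))%:E.
  set u := c * x.
  rewrite -[RHS](_ : (r * ((1 - e) * u ^+ 2 + e ^+ 2 + u ^+ 4 / 4)
     + r * ((1 - e) * d ^+ 2 + 6 * u ^+ 2 * d ^+ 2 / 4)
     + 3 * (r * d ^+ 4 / 4))%:E = _); last by congr EFin; rewrite /inner; field.
  (* The coefficients of [y] and [y^3] have to be supplied, since the value of the integral does not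
     show them. *)
  rewrite -(@integral_normal_poly4 _ (r * (2 * (1 - e) * u * d + u ^+ 3 * d))
    _ (r * u * d ^+ 3)).
    by apply: eq_integral => y _; congr EFin; field.
  move=> y; rewrite (_ : _ + _ = r * ((u + d * y) ^+ 2 + (e - (u + d * y) ^+ 2 / 2) ^+ 2))//.
  by field.
transitivity (\int[gamma]_x (inner (c * x))%:E)%E.
  by apply: eq_integral => x _; exact: innerE.
rewrite -[RHS](_ : (r * ((1 - e) * d ^+ 2 + e ^+ 2 + 3 * d ^+ 4 / 4)
     + r * ((1 - e) * c ^+ 2 + 6 * c ^+ 2 * d ^+ 2 / 4)
     + 3 * (r * c ^+ 4 / 4))%:E = _); last by congr EFin; field.
rewrite -(@integral_normal_poly4 _ 0 _ 0).
  by apply: eq_integral => x _; congr EFin; rewrite /inner; field.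
(* As [1 - e] may be negative, the sign of [inner] is not visible in its polynomial form; it is
   inherited from the nonnegative integral that [inner] equals. *)
move=> x; rewrite -lee_fin.
rewrite (_ : (_ + _)%:E = (inner (c * x))%:E); last by congr EFin; rewrite /inner; field.
by rewrite -innerE; apply: integral_ge0 => y _; rewrite lee_fin.
Qed.

End normal_poly.

(** * Independence *)

Lemma ex_density_measure (d : measure_display) (T : measurableType d)
    (R : realType) (mu : {measure set T -> \bar R}) (D : T -> R) :
  (forall x, 0 <= D x) -> measurable_fun [set: T] D ->
  exists nu : {measure set T -> \bar R},
    forall A, measurable A -> nu A = (\int[mu]_(x in A) (D x)%:E)%E.
Proof.
move=> D0 mD; pose nu (A : set T) := (\int[mu]_(x in A) (D x)%:E)%E.
have nu0 : nu set0 = 0%E by rewrite /nu integral_set0.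
have nu_ge0 A : (0 <= nu A)%E by apply: integral_ge0 => x _; rewrite lee_fin.
have nu_sa : semi_sigma_additive nu.
  apply: semi_sigma_additive_nng_induced => [|x]; last by rewrite lee_fin.
  exact/measurable_EFinP.
pose m := isMeasure.Build _ _ _ nu nu0 nu_ge0 nu_sa.
pose nu' : {measure set T -> \bar R} := HB.pack nu m.
by exists nu'.
Qed.

Section independence.
Context (R : realType) d (T : measurableType d) (P : probability T R).
Context d1 (T1 : measurableType d1) d2 (T2 : measurableType d2).

(** The measure with density [D], pushed forward by [(a, b)], agrees with [c] times [m1 \x m2] on
    rectangles, hence everywhere by uniqueness of product measures. The weight [D] will carry the
    past of the noise and events of its future. *)
Lemma integral_independent_pair (a : T -> T1) (b : T -> T2)
    (m1 : probability T1 R) (m2 : probability T2 R)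
    (D : T -> R) (c : R) (g : T1 -> T2 -> R) :
  measurable_fun [set: T] a -> measurable_fun [set: T] b ->
  (forall x, 0 <= D x) -> measurable_fun [set: T] D -> 0 <= c ->
  (forall x y, 0 <= g x y) -> measurable_fun [set: T1 * T2] (fun p => g p.1 p.2) ->
  (forall A B, measurable A -> measurable B ->
    (\int[P]_(w in a @^-1` A `&` b @^-1` B) (D w)%:E = c%:E * m1 A * m2 B)%E) ->
  (\int[P]_w (g (a w) (b w) * D w)%:E
    = c%:E * \int[m1]_x \int[m2]_y (g x y)%:E)%E.
Proof.
move=> ma mb D0 mD c0 g0 mg H.
have [nu nuE] := @ex_density_measure _ _ _ P _ D0 mD.
pose f w := (a w, b w).
have mf : measurable_fun [set: T] f by exact: measurable_fun_pair.
pose G (p : T1 * T2) := (g p.1 p.2)%:E.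
have mG : measurable_fun [set: T1 * T2] G.
  exact/measurable_EFinP.
have G0 p : (0 <= G p)%E by rewrite lee_fin.
pose m' : {measure set (T1 * T2) -> \bar R} :=
  measure_function_pushforward__canonical__measure_function_Measure nu mf.
(* Absorbing the constant into the first factor makes the target measure itself a product
   measure. *)
pose cm1 := mscale (NngNum c0) m1.
have m'E A B : measurable A -> measurable B -> m' (A `*` B) = (cm1 A * m2 B)%E.
  move=> mA mB; rewrite [LHS]nuE/=; last first.
    by rewrite -[X in measurable X]setTI; exact: (mf measurableT _ (measurableX mA mB)).
  by rewrite H.
transitivity (\int[m']_p G p)%E.
  rewrite [RHS](ge0_integral_pushforward mf nu measurableT mG) => [|p _]; last exact: G0.
  rewrite (@ge0_integral_density _ _ _ P nu D D0 mD nuE (G \o f)) => [//||x].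
    exact: measurableT_comp.
  exact: G0.
transitivity (\int[cm1 \x m2]_p G p)%E.
  by apply/esym/eq_measure_integral => A mA _; exact: product_measure_unique.
rewrite (fubini_tonelli1 G mG G0) ge0_integral_mscale//.
- exact: (measurable_fun_fubini_tonelli_F G mG G0).
- by move=> x _; apply: integral_ge0 => y _; rewrite lee_fin.
Qed.

End independence.

Section iid_product.
Context (R : realType) d (T : measurableType d) (P : probability T R).
Variables Zx Zy : nat -> {RV P >-> R}.
Hypothesis hZ : gaussian_noise Zx Zy.
Variables (g : R -> R -> R) (q : R).
Hypothesis g0 : forall x y, 0 <= g x y.
Hypothesis mg : measurable_fun [set: R * R] (fun p => g p.1 p.2).
Local Notation gamma := (@normal_prob R 0 1).
Hypothesis gq : (\int[gamma]_x \int[gamma]_y (g x y)%:E = q%:E)%E.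

Let W (i : nat + nat) : {RV P >-> R} :=
  match i with inl n => Zx n | inr n => Zy n end.
Let time (i : nat + nat) : nat := match i with inl n => n | inr n => n end.
Let S (n : nat) (w : T) := \prod_(m < n) g (Zx m w) (Zy m w).

Let q0 : 0 <= q.
Proof.
rewrite -lee_fin -gq; apply: integral_ge0 => x _.
by apply: integral_ge0 => y _; rewrite lee_fin.
Qed.

Let S0 n w : 0 <= S n w.
Proof. by apply: prodr_ge0. Qed.

Let mgZ n : measurable_fun [set: T] (fun w => g (Zx n w) (Zy n w)).
Proof.
apply: (measurableT_comp (g := fun w => (Zx n w, Zy n w)) mg).
exact: measurable_fun_pair.
Qed.

Let mS n : measurable_fun [set: T] (S n).
Proof.
rewrite /S; elim: n => [|n IH].
  under eq_fun do rewrite big_ord0; exact: measurable_cst.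
under eq_fun do rewrite big_ord_recr/=; exact: measurable_funM.
Qed.

Let WE i A : measurable A -> P (W i @^-1` A) = gamma A.
Proof. by case: i => n mA /=; [apply: hZ.1|apply: hZ.2.1]. Qed.

(* Keeping arbitrary events of the later noise variables in the statement lets
   the induction split off the two variables of one step at a time. *)
Let integral_product_event n (s : seq (nat + nat)) (A : nat + nat -> set R) :
  uniq s -> (forall i, i \in s -> (n <= time i)%N) ->
  (forall i, i \in s -> measurable (A i)) ->
  (\int[P]_(w in \bigcap_(i in [set` s]) (W i @^-1` A i)) (S n w)%:E
   = (q ^+ n)%:E * \prod_(i <- s) P (W i @^-1` A i))%E.
Proof.
elim: n s A => [|n IH] s A us ts mA.
  rewrite expr0 mul1e -(hZ.2.2 s A us mA).
  rewrite -[RHS]mul1e -integral_cst//; last first.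
    apply: fin_bigcap_measurable => // i /= si.
    by rewrite -[X in measurable X]setTI; apply: measurable_funPT => //; exact: mA.
  by apply: eq_integral => w _; rewrite /S big_ord0.
set E := \bigcap_(i in [set` s]) (W i @^-1` A i).
have mE : measurable E.
  apply: fin_bigcap_measurable => // i /= si.
  by rewrite -[X in measurable X]setTI; apply: measurable_funPT => //; exact: mA.
pose D w := S n w * \1_E w.
have D0 w : 0 <= D w by rewrite mulr_ge0.
have mD : measurable_fun [set: T] D by apply: measurable_funM.
(* The constant in [integral_independent_pair] is a real number, so the product of probabilities
   must first be recognised as finite. *)
have prodfin (r : seq (nat + nat)) (B : nat + nat -> set R) :
    (forall i, i \in r -> measurable (B i)) ->
    exists2 x : R, 0 <= x & (\prod_(i <- r) P (W i @^-1` B i))%E = x%:E.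
  elim: r => [_|i r IHr mB]; first by exists 1 => //; rewrite big_nil.
  have [j jr|x x0 Ex] := IHr; first by apply: mB; rewrite in_cons jr orbT.
  rewrite big_cons Ex.
  have Pf : P (W i @^-1` B i) \is a fin_num.
    apply: fin_num_measure; rewrite -[X in measurable X]setTI.
    by apply: measurable_funPT => //; apply: mB; rewrite mem_head.
  exists (fine (P (W i @^-1` B i)) * x); first by rewrite mulr_ge0// fine_ge0.
  by rewrite EFinM fineK.
have [x x0 Ex] := prodfin s A mA.
have /= := @integral_independent_pair R _ T P _ (measurableTypeR R) _ (measurableTypeR R)
  (Zx n) (Zy n) gamma gamma D (q ^+ n * x) g.
rewrite gq Ex.
have -> : ((q ^+ n.+1)%:E * x%:E = (q ^+ n * x)%:E * q%:E)%E.
  by rewrite -!EFinM exprS; congr EFin; ring.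
move=> <-.
- rewrite integral_mkcond; apply: eq_integral => w _.
  rewrite patchE /D indicE; case: ifPn => _; last by rewrite !mulr0.
  by rewrite mulr1 /S big_ord_recr/= mulrC.
- exact: (@measurable_funPT _ _ _ _ (Zx n)).
- exact: (@measurable_funPT _ _ _ _ (Zy n)).
- exact: D0.
- exact: mD.
- by rewrite mulr_ge0// exprn_ge0.
- exact: g0.
- exact: mg.
move=> A1 A2 mA1 mA2.
(* The rectangle test adds two events at time [n]. All indices in [s] have time at least [n.+1], so
   overriding [A] there does not disturb [s], and the induction hypothesis applies to the longer
   list. *)
pose B i := if i == inl n then A1 else if i == inr n then A2 else A i.
have nls : inl n \notin s by apply/negP => /ts /=; rewrite ltnn.
have nrs : inr n \notin s by apply/negP => /ts /=; rewrite ltnn.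
have BL : B (inl n) = A1 by rewrite /B eqxx.
have BR : B (inr n) = A2 by rewrite /B eqxx.
have BA i : i \in s -> B i = A i.
  move=> si; rewrite /B; case: eqVneq => [ei|_]; first by rewrite ei (negbTE nls) in si.
  by case: eqVneq => [ei|//]; rewrite ei (negbTE nrs) in si.
have := IH [:: inl n, inr n & s] B.
rewrite /= !in_cons negb_or nls nrs us /= => /(_ isT).
rewrite !big_cons.
have -> : (\prod_(j <- s) P (W j @^-1` B j) = \prod_(j <- s) P (W j @^-1` A j))%E.
  by apply: eq_big_seq => j js; rewrite BA.
have mB i : i \in [:: inl n, inr n & s] -> measurable (B i).
  by rewrite !in_cons => /or3P[/eqP->|/eqP->|si]; rewrite ?BL ?BR// BA//; exact: mA.
rewrite Ex BL BR !WE//.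
move=> IH'; transitivity ((q ^+ n)%:E * (gamma A1 * (gamma A2 * x%:E)))%E; last first.
  by rewrite EFinM -!muleA; congr (_ * _)%E; rewrite [LHS]muleA muleC.
rewrite -IH'.
- rewrite integral_mkcond [RHS]integral_mkcond; apply: eq_integral => w _.
  rewrite !patchE /D indicE.
  have -> : (w \in \bigcap_(i in [set` [:: inl n, inr n & s]]) (W i @^-1` B i))
     = (w \in Zx n @^-1` A1 `&` Zy n @^-1` A2) && (w \in E).
    rewrite -in_setI; apply/idP/idP; rewrite !inE.
      move=> Bw; split; last first.
        by move=> i /= si; rewrite -BA//; apply: Bw; rewrite /= !in_cons si !orbT.
      by split; [rewrite -BL|rewrite -BR]; apply: Bw => /=; rewrite !in_cons eqxx ?orbT.
    move=> [[A1w A2w] Ew] i /=; rewrite !in_cons => /or3P[/eqP->|/eqP->|si].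
    - by rewrite BL.
    - by rewrite BR.
    - by rewrite BA//; exact: Ew.
  by case: (w \in E); rewrite ?andbT ?andbF ?mulr1 ?mulr0//; case: ifP.
- move=> i; rewrite !in_cons => /or3P[/eqP->|/eqP->|si]//=.
  by rewrite ltnW// ts.
- exact: mB.
Qed.

Lemma expectation_iid_product n :
  ('E_P[fun w => (\prod_(m < n) g (Zx m w) (Zy m w))%R] = (q ^+ n)%:E)%E.
Proof.
have := @integral_product_event n [::] (fun=> setT) isT.
rewrite big_nil mule1 => <-//.
rewrite unlock; congr (integral _ _ _).
by rewrite set_nil bigcap_set0.
Qed.

End iid_product.

(** * The mean-square estimate *)

(** Bounding the mixed term by [|rho| s^2] leaves the coefficient [(1 + 2 |rho|) / 2] on [p^4] and
    [q^4], and [3 rho^2 + 2 |rho| + 1] on [p^2 q^2]. The three hypotheses say precisely that these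
    terms fit under [al^2], [be^2] and [2 al be]. Strictness comes from the linear terms,
    [s < 2 (al + be)], because [rhox, rhoy < 1]. *)
Lemma mean_square_symbol_lt (R : realFieldType) (rhox rhoy rho al be p q : R) :
  0 <= rhox < 1 -> 0 <= rhoy < 1 ->
  2 * rhox ^+ 2 * (1 + 2 * `|rho|) < 1 ->
  2 * rhoy ^+ 2 * (1 + 2 * `|rho|) < 1 ->
  2 * rhox * rhoy * (3 * rho ^+ 2 + 2 * `|rho| + 1) < 1 ->
  0 <= al -> 0 <= be -> 0 < al + be ->
  p ^+ 2 <= 2 * rhox * al -> q ^+ 2 <= 2 * rhoy * be ->
  1 + (p ^+ 2 + q ^+ 2) + (p ^+ 2 + q ^+ 2) ^+ 2 / 2
    + 2 * (p ^+ 2 + q ^+ 2) * rho * p * q + 3 * rho ^+ 2 * p ^+ 2 * q ^+ 2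
  < (1 + (al + be)) ^+ 2.
Proof.
move=> /andP[rx0 rx1] /andP[ry0 ry1] hx hy hxy al0 be0 albe hp hq; set s := p ^+ 2 + q ^+ 2.
have t2 : rho ^+ 2 = `|rho| ^+ 2 by rewrite real_normK// num_real.
rewrite t2 in hxy; rewrite t2.
have t0 : 0 <= `|rho| by [].
have pq : `|p * q| <= s / 2.
  rewrite normrM /s -(real_normK (num_real p)) -(real_normK (num_real q)).
  have := sqr_ge0 (`|p| - `|q|); lra.
have s0 : 0 <= s by rewrite /s addr_ge0// sqr_ge0.
have cross : 2 * s * rho * p * q <= `|rho| * s ^+ 2.
  have h1 : rho * (p * q) <= `|rho| * (s / 2).
    by apply: le_trans (ler_norm _) _; rewrite normrM ler_wpM2l.
  have := ler_wpM2l s0 h1; lra.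
have P0 : 0 <= p ^+ 2 by exact: sqr_ge0.
have Q0 : 0 <= q ^+ 2 by exact: sqr_ge0.
have PP : p ^+ 2 * p ^+ 2 <= (2 * rhox * al) * (2 * rhox * al) by exact: ler_pM.
have QQ : q ^+ 2 * q ^+ 2 <= (2 * rhoy * be) * (2 * rhoy * be) by exact: ler_pM.
have PQ : p ^+ 2 * q ^+ 2 <= (2 * rhox * al) * (2 * rhoy * be) by exact: ler_pM.
have A1 : (1 + 2 * `|rho|) * (p ^+ 2 * p ^+ 2) <= 2 * al ^+ 2.
  apply: (@le_trans _ _ ((1 + 2 * `|rho|) * ((2 * rhox * al) * (2 * rhox * al)))).
    by apply: ler_wpM2l => //; lra.
  have := ler_wpM2r (sqr_ge0 al) (ltW hx); lra.
have A2 : (1 + 2 * `|rho|) * (q ^+ 2 * q ^+ 2) <= 2 * be ^+ 2.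
  apply: (@le_trans _ _ ((1 + 2 * `|rho|) * ((2 * rhoy * be) * (2 * rhoy * be)))).
    by apply: ler_wpM2l => //; lra.
  have := ler_wpM2r (sqr_ge0 be) (ltW hy); lra.
have A3 : (3 * `|rho| ^+ 2 + 2 * `|rho| + 1) * (p ^+ 2 * q ^+ 2) <= 2 * (al * be).
  apply: (@le_trans _ _ ((3 * `|rho| ^+ 2 + 2 * `|rho| + 1) * ((2 * rhox * al) * (2 * rhoy * be)))).
    by apply: ler_wpM2l => //; have := sqr_ge0 `|rho|; lra.
  have := ler_wpM2r (mulr_ge0 al0 be0) (ltW hxy); lra.
have A4 : s < 2 * (al + be).
  have : 0 < (1 - rhox) * al + (1 - rhoy) * be.
    have [al00|al1] := eqVneq al 0.
      have be1 : 0 < be by lra.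
      have : 0 < (1 - rhoy) * be by rewrite mulr_gt0 ?subr_gt0.
      rewrite al00; lra.
    have : 0 < (1 - rhox) * al by rewrite mulr_gt0 ?subr_gt0// lt_def al1.
    have : 0 <= (1 - rhoy) * be by apply: mulr_ge0 => //; rewrite subr_ge0 ltW.
    lra.
  rewrite /s; lra.
have sE : s ^+ 2 = p ^+ 2 * p ^+ 2 + 2 * (p ^+ 2 * q ^+ 2) + q ^+ 2 * q ^+ 2.
  by rewrite /s; ring.
rewrite sE in cross; rewrite sE; lra.
Qed.

(** * Uniqueness of Fourier coefficients *)

Section trigonometric_uniqueness.
Variables (R : realType) (h : R).
Hypothesis h0 : 0 < h.
Local Notation mu := (@lebesgue_measure R).
Local Notation L := (pi / h).
Local Notation I := (`[- L, L]%classic : set R).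

Let within_integrable (f : R -> R) :
  {within I, continuous f} -> mu.-integrable I (EFin \o f).
Proof. by apply: continuous_compact_integrable; exact: segment_compact. Qed.

(* Lebesgue's peaking kernel: its powers blow up near [t0] and stay bounded by
   1 in absolute value on the rest of the period. *)
Let peak (delta t0 t : R) : R := 1 - cos (h * delta) + cos (h * (t - t0)).

Let continuous_cosZ (m : int) : continuous (fun t : R => cos (m%:~R * t * h)).
Proof.
move=> t; apply: (@continuous_comp _ _ _ (fun t : R => m%:~R * t * h) cos);
  last exact: continuous_cos.
by apply: cvgM; [apply: cvgM; [exact: cvg_cst|exact: cvg_id]|exact: cvg_cst].
Qed.

Let continuous_sinZ (m : int) : continuous (fun t : R => sin (m%:~R * t * h)).
Proof.
move=> t; apply: (@continuous_comp _ _ _ (fun t : R => m%:~R * t * h) sin);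
  last exact: continuous_sin.
by apply: cvgM; [apply: cvgM; [exact: cvg_cst|exact: cvg_id]|exact: cvg_cst].
Qed.

Let continuous_peak (delta t0 : R) : continuous (peak delta t0).
Proof.
move=> t; apply: cvgD; first exact: cvg_cst.
apply: (@continuous_comp _ _ _ (fun t : R => h * (t - t0)) cos); last exact: continuous_cos.
by apply: cvgM; [exact: cvg_cst|apply: cvgB; [exact: cvg_id|exact: cvg_cst]].
Qed.

Let continuous_peakX (delta t0 : R) n : continuous (fun t => peak delta t0 t ^+ n).
Proof.
by move=> t; apply: (@continuous_comp _ _ _ (peak delta t0) (fun x => x ^+ n));
  [exact: continuous_peak|exact: exprn_continuous].
Qed.

Let continuous_withinM (f g : R -> R) :
  {within I, continuous f} -> continuous g -> {within I, continuous (fun t => f t * g t)}.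
Proof.
move=> cf cg x; apply: cvgM; first exact: cf.
by have := continuous_subspaceT cg; apply.
Qed.

(** Powers of [peak] are trigonometric polynomials. One more factor mixes frequencies [m - 1], [m],
    [m + 1] and cosines with sines, so the induction carries both families for every [m]. *)
Let integral_peak_eq0 (f : R -> R) (delta t0 : R) :
  {within I, continuous f} ->
  (forall m : int, \int[mu]_(t in I) (f t * cos (m%:~R * t * h)) = 0)%R ->
  (forall m : int, \int[mu]_(t in I) (f t * sin (m%:~R * t * h)) = 0)%R ->
  forall n, (\int[mu]_(t in I) (f t * peak delta t0 t ^+ n) = 0)%R.
Proof.
move=> cf fcos fsin n.
pose C n (m : int) t := f t * peak delta t0 t ^+ n * cos (m%:~R * t * h).
pose S n (m : int) t := f t * peak delta t0 t ^+ n * sin (m%:~R * t * h).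
have H : (forall m : int, \int[mu]_(t in I) C n m t = 0)%R /\
    (forall m : int, \int[mu]_(t in I) S n m t = 0)%R.
  elim: n => [|n [IHc IHs]].
    by split => m; [rewrite -[RHS](fcos m)|rewrite -[RHS](fsin m)];
      apply: eq_Rintegral => t _; rewrite /C /S expr0 mulr1.
  have cF : {within I, continuous (fun t => f t * peak delta t0 t ^+ n)}.
    exact: continuous_withinM.
  have ic m : mu.-integrable I (EFin \o C n m).
    exact/within_integrable/continuous_withinM.
  have is_ m : mu.-integrable I (EFin \o S n m).
    exact/within_integrable/continuous_withinM.
  (* By the product-to-sum formulas, [peak] times a cosine or sine of frequency [m] is a combination
     of five such functions; [a] to [e] are its coefficients. *)
  have comb (a b c d e : R) (u v w x y : R -> R) : 
      mu.-integrable I (EFin \o u) -> mu.-integrable I (EFin \o v) ->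
      mu.-integrable I (EFin \o w) -> mu.-integrable I (EFin \o x) ->
      mu.-integrable I (EFin \o y) ->
      (\int[mu]_(t in I) u t = 0)%R -> (\int[mu]_(t in I) v t = 0)%R ->
      (\int[mu]_(t in I) w t = 0)%R -> (\int[mu]_(t in I) x t = 0)%R ->
      (\int[mu]_(t in I) y t = 0)%R ->
      (\int[mu]_(t in I) (a * u t + b * v t + c * w t + d * x t + e * y t) = 0)%R.
    move=> iu iv iw ix iy u0 v0 w0 x0 y0.
    have sc (k : R) (z : R -> R) : mu.-integrable I (EFin \o z) ->
      mu.-integrable I (EFin \o (fun t => k * z t)).
      by move=> iz; exact: (integrableZl _ k iz).
    have ad (z1 z2 : R -> R) : mu.-integrable I (EFin \o z1) -> mu.-integrable I (EFin \o z2) ->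
      mu.-integrable I (EFin \o (fun t => z1 t + z2 t)).
      by move=> iz1 iz2; exact: (integrableD _ iz1 iz2).
    have i1 := ad _ _ (sc a _ iu) (sc b _ iv).
    have i2 := ad _ _ i1 (sc c _ iw).
    have i3 := ad _ _ i2 (sc d _ ix).
    rewrite (RintegralD _ i3 (sc e _ iy))// (RintegralD _ i2 (sc d _ ix))//.
    rewrite (RintegralD _ i1 (sc c _ iw))// (RintegralD _ (sc a _ iu) (sc b _ iv))//.
    by rewrite !RintegralZl// u0 v0 w0 x0 y0 !mulr0 !addr0.
  have e1 (m : int) t : (m + 1)%:~R * t * h = m%:~R * t * h + t * h.
    by rewrite intrD; ring.
  have e2 (m : int) t : (m - 1)%:~R * t * h = m%:~R * t * h - t * h.
    by rewrite intrB; ring.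
  have pkE t : peak delta t0 t = 1 - cos (h * delta) +
      (cos (h * t0) * cos (t * h) + sin (h * t0) * sin (t * h)).
    rewrite /peak mulrBr cosB (mulrC h t); ring.
  split => m.
    rewrite -[RHS](comb (1 - cos (h * delta)) (cos (h * t0) / 2) (cos (h * t0) / 2)
      (sin (h * t0) / 2) (- (sin (h * t0) / 2))
      (C n m) (C n (m + 1)) (C n (m - 1)) (S n (m + 1)) (S n (m - 1))
      (ic _) (ic _) (ic _) (is_ _) (is_ _) (IHc _) (IHc _) (IHc _) (IHs _) (IHs _)).
    apply: eq_Rintegral => t _; rewrite /C /S e1 e2 !cosD !sinD cosN sinN exprS pkE.
    by field.
  rewrite -[RHS](comb (1 - cos (h * delta)) (cos (h * t0) / 2) (cos (h * t0) / 2)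
      (sin (h * t0) / 2) (- (sin (h * t0) / 2))
      (S n m) (S n (m + 1)) (S n (m - 1)) (C n (m - 1)) (C n (m + 1))
      (is_ _) (is_ _) (is_ _) (ic _) (ic _) (IHs _) (IHs _) (IHs _) (IHc _) (IHc _)).
  apply: eq_Rintegral => t _; rewrite /C /S e1 e2 !cosD !sinD cosN sinN exprS pkE.
  by field.
rewrite -[RHS](H.1 0); apply: eq_Rintegral => t _.
by rewrite /C !mul0r cos0 mulr1.
Qed.

(** With [t0 - delta] and [t0 + delta] inside the period, [t] stays at distance over [delta] from
    [t0] even modulo the period. An angle beyond [pi] is reflected to [2 pi] minus itself before
    comparing cosines. *)
Let peak_le1 (delta t0 t : R) : 0 < delta -> - L < t0 - delta -> t0 + delta < L ->
  - L <= t <= L -> delta < `|t - t0| -> `|peak delta t0 t| <= 1.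
Proof.
move=> d0 Lt0 t0L /andP[Lt tL] dt; rewrite /peak.
have hL : h * L = pi by rewrite mulrC divfK// gt_eqF.
have hd : h * delta < pi by rewrite -hL ltr_pM2l//; lra.
have hd0 : 0 < h * delta by rewrite mulr_gt0.
have cosd : cos (h * (t - t0)) <= cos (h * delta).
  rewrite -cos_norm normrM (gtr0_norm h0).
  have tt : h * `|t - t0| < pi *+ 2 - h * delta.
    rewrite -hL -mulrnAr -mulrBr ltr_pM2l//.
    by rewrite ltr_norml; apply/andP; split; lra.
  have dt' : h * delta < h * `|t - t0| by rewrite ltr_pM2l.
  have [tpi|pit] := leP (h * `|t - t0|) pi.
    by apply/ltW; rewrite ltr_cos// in_itv/=; apply/andP; split; lra.
  rewrite -(cosN (h * `|t - t0|)) -(cosD2pi (- _)).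
  by apply/ltW; rewrite ltr_cos ?in_itv/=; [|apply/andP; split|apply/andP; split]; lra.
rewrite ler_norml; have := cos_geN1 (h * (t - t0)); have := cos_le1 (h * delta).
by move=> *; apply/andP; split; lra.
Qed.

Let peak_ge1 (delta t0 t : R) : 0 < delta -> delta < L ->
  `|t - t0| <= delta -> 1 <= peak delta t0 t.
Proof.
move=> d0 dL dt; rewrite /peak.
have hL : h * L = pi by rewrite mulrC divfK// gt_eqF.
have hd : h * delta < pi by rewrite -hL ltr_pM2l.
have hd0 : 0 < h * delta by rewrite mulr_gt0.
suff : cos (h * delta) <= cos (h * (t - t0)) by lra.
rewrite -(cos_norm (h * (t - t0))) normrM (gtr0_norm h0).
have : h * `|t - t0| <= h * delta by rewrite ler_pM2l.
rewrite le_eqVlt => /predU1P[->//|ht]; apply/ltW.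
have : 0 <= h * `|t - t0| by rewrite mulr_ge0// ltW.
by move=> ?; rewrite ltr_cos// in_itv/=; apply/andP; split; lra.
Qed.

Let peak_gt1 (delta t0 : R) : 0 < delta -> delta < L -> exists2 eta : R, 0 < eta &
  forall t, `|t - t0| <= delta / 2 -> 1 + eta <= peak delta t0 t.
Proof.
move=> d0 dL.
have hL : h * L = pi by rewrite mulrC divfK// gt_eqF.
have hd : h * delta < pi by rewrite -hL ltr_pM2l.
have hd0 : 0 < h * delta by rewrite mulr_gt0.
exists (cos (h * (delta / 2)) - cos (h * delta)).
  by rewrite subr_gt0 ltr_cos ?in_itv/=; [|apply/andP; split|apply/andP; split]; lra.
move=> t dt; rewrite /peak.
suff : cos (h * (delta / 2)) <= cos (h * (t - t0)) by lra.
rewrite -(cos_norm (h * (t - t0))) normrM (gtr0_norm h0).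
have : h * `|t - t0| <= h * (delta / 2) by rewrite ler_pM2l.
rewrite le_eqVlt => /predU1P[->//|ht]; apply/ltW.
have : 0 <= h * `|t - t0| by rewrite mulr_ge0// ltW.
by move=> ?; rewrite ltr_cos// in_itv/=; apply/andP; split; lra.
Qed.

Let L0 : 0 < L. Proof. by rewrite divr_gt0// pi_gt0. Qed.

(** If [f t0 > 0], the integral of [f * peak^n] would grow at least linearly in [n]: it grows near
    [t0], is nonnegative slightly further out and bounded elsewhere. But it is zero for every
    [n]. *)
Let fourier_coefficients_le0 (f : R -> R) (t0 : R) :
  {within I, continuous f} ->
  (forall m : int, \int[mu]_(t in I) (f t * cos (m%:~R * t * h)) = 0)%R ->
  (forall m : int, \int[mu]_(t in I) (f t * sin (m%:~R * t * h)) = 0)%R ->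
  - L < t0 < L -> f t0 <= 0.
Proof.
move=> cf fcos fsin /andP[Lt0 t0L]; rewrite leNgt; apply/negP => ft0.
pose e := f t0 / 2; have e0 : 0 < e by rewrite divr_gt0.
have NLL : - L < L by lra.
have [cfI _ _] := (continuous_within_itvP f NLL).1 cf.
have t0I : t0 \in `]- L, L[ by rewrite in_itv/= Lt0.
have /cvgrPdist_lt/(_ e e0)[d /= d0 Hd] := cfI t0 t0I.
(* The first bound keeps [f] above [e] on the closed [delta]-neighbourhood of [t0]; the other two
   keep that neighbourhood strictly inside the period. *)
pose delta := Num.min (d / 2) (Num.min ((L - t0) / 2) ((t0 + L) / 2)).
have delta0 : 0 < delta by rewrite !lt_min; apply/and3P; split; lra.
have deltad : delta <= d / 2 by rewrite ge_min lexx.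
have deltaL : delta <= (L - t0) / 2 by rewrite !ge_min lexx !orbT.
have deltaR : delta <= (t0 + L) / 2 by rewrite !ge_min lexx !orbT.
have dL : delta < L by lra.
have fe t : `|t - t0| <= delta -> e <= f t.
  move=> tt; have := Hd t; rewrite /ball_/= distrC => /(_ _).
  have -> : `|t - t0| < d by lra.
  by move=> /(_ isT); rewrite ltr_norml => /andP[_]; rewrite /e; lra.
have [M [M0 HM]] : exists M : R, 0 <= M /\ forall t : R, - L <= t <= L -> `|f t| <= M.
  have /compact_bounded[M [_ HM]] := continuous_compact cf (@segment_compact _ (- L) L).
  exists (`|M| + 1); split; first by rewrite addr_ge0.
  move=> t tI; apply: (HM (`|M| + 1)).
    by rewrite (le_lt_trans (ler_norm M))// ltrDl.
  by exists t => //=; rewrite in_itv/=.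
have [eta eta0 Heta] := peak_gt1 delta t0 delta0 dL.
pose A : set R := `[t0 - delta / 2, t0 + delta / 2]%classic.
have AI : A `<=` I.
  by move=> t; rewrite /A /= !in_itv/= => /andP[? ?]; apply/andP; split; lra.
have key n : e * (1 + n%:R * eta) * delta <= M * (2 * L).
  pose K := e * (1 + n%:R * eta).
  have K0 : 0 <= K.
    by rewrite mulr_ge0// ?(ltW e0)// addr_ge0// mulr_ge0// ltW.
  have mI : measurable (I : set (measurableTypeR R)) by exact: measurable_itv.
  have mA : measurable (A : set (measurableTypeR R)) by exact: measurable_itv.
  have iA1 : mu.-integrable I (EFin \o (\1_A : R -> R)).
    apply: (le_integrable mI (g := EFin \o cst (1 : R))).
    - by apply/measurable_EFinP; apply: measurable_indic.
    - by move=> t _ /=; rewrite lee_fin indicE; case: (_ \in _); rewrite ?normr0 ?normr1.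
    - by apply: within_integrable => x; exact: cvg_cst.
  have iA : mu.-integrable I (EFin \o (fun t => K * \1_A t)).
    exact: (integrableZl mI K iA1).
  have iM : mu.-integrable I (EFin \o (fun t => - M)).
    by apply: within_integrable => x; exact: cvg_cst.
  have ipeak : mu.-integrable I (EFin \o (fun t => f t * peak delta t0 t ^+ n)).
    by apply: within_integrable; apply: continuous_withinM => //; exact: continuous_peakX.
  (* The minorant [K \1_A - M] covers three zones: at least [K] on [A], at least [0] up to distance
     [delta], at least [- M] beyond, where [peak] is bounded by 1. Its integral is
     [K delta - 2 L M]. *)
  have : (\int[mu]_(t in I) (K * \1_A t + - M) <=
         \int[mu]_(t in I) (f t * peak delta t0 t ^+ n))%R.
    apply: le_Rintegral => //; first exact: (integrableD mI iA iM).
    move=> t; rewrite /= in_itv/= => tI.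
    have [tA|tA] := boolP (`|t - t0| <= delta / 2).
      rewrite indicE mem_set; last first.
        by rewrite /A /= in_itv/= -ler_distlC distrC.
      have ft : e <= f t by apply: fe; lra.
      have pt := Heta t tA.
      (* Bernoulli's inequality; linear growth in [n] already gives the contradiction. *)
      have p1 : 1 + n%:R * eta <= peak delta t0 t ^+ n.
        apply: (@le_trans _ _ ((1 + eta) ^+ n)).
          elim: n {K K0 iA ipeak} => [|n IH]; first by rewrite expr0 mul0r addr0.
          rewrite exprS -(natr1 n).
          have h1 : (1 + eta) * (1 + n%:R * eta) <= (1 + eta) * (1 + eta) ^+ n.
            by rewrite ler_pM2l//; lra.
          have h2 : 0 <= n%:R * (eta * eta) by rewrite mulr_ge0// mulr_ge0// ltW.
          lra.
        by apply: lerXn2r => //; rewrite ?nnegrE; lra.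
      have : K <= f t * peak delta t0 t ^+ n.
        by apply: ler_pM => //; [lra|rewrite addr_ge0// mulr_ge0// ltW].
      rewrite mulr1; lra.
    rewrite indicE memNset; last first.
      by rewrite /A /= in_itv/= -ler_distlC distrC; exact/negP.
    rewrite mulr0 add0r.
    have [td|td] := leP `|t - t0| delta.
      apply: (@le_trans _ _ 0); first lra.
      apply: mulr_ge0; first by have := fe t td; lra.
      by apply: exprn_ge0; have := peak_ge1 delta t0 t delta0 dL td; lra.
    have := ler_norm (- (f t * peak delta t0 t ^+ n)).
    rewrite normrN normrM normrX.
    have : `|f t| * `|peak delta t0 t| ^+ n <= M * 1.
      apply: ler_pM => //; first exact: HM.
      apply: exprn_ile1 => //.
      by apply: peak_le1 => //; lra.
    lra.
  rewrite integral_peak_eq0//.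
  rewrite (RintegralD mI iA iM).
  rewrite Rintegral_cst// RintegralZl//.
  rewrite /Rintegral integral_indic// (setIidl AI).
  rewrite /A /= !lebesgue_measure_itv/= !lte_fin.
  have -> : t0 - delta / 2 < t0 + delta / 2 by lra.
  rewrite NLL/= -/K; lra.
have ed : 0 < e * delta * eta by rewrite !mulr_gt0.
have := key (Num.bound (M * (2 * L) / (e * delta * eta))).
set N := Num.bound _ => keyN.
have : M * (2 * L) / (e * delta * eta) < N%:R.
  apply: archi_boundP; apply: divr_ge0; last exact: ltW.
  by apply: mulr_ge0 => //; apply: mulr_ge0 => //; exact: ltW L0.
rewrite ltr_pdivrMr// => HN.
have : 0 < e * delta by rewrite mulr_gt0.
lra.
Qed.

Let fourier_coefficients_eq0_interior (f : R -> R) (t0 : R) :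
  {within I, continuous f} ->
  (forall m : int, \int[mu]_(t in I) (f t * cos (m%:~R * t * h)) = 0)%R ->
  (forall m : int, \int[mu]_(t in I) (f t * sin (m%:~R * t * h)) = 0)%R ->
  - L < t0 < L -> f t0 = 0.
Proof.
move=> cf fcos fsin t0I; apply/eqP; rewrite eq_le fourier_coefficients_le0//=.
have opp (g : R -> R) : continuous g -> (\int[mu]_(t in I) (f t * g t) = 0 ->
    \int[mu]_(t in I) (- f t * g t) = 0)%R.
  move=> cg fg; rewrite -[RHS](mulr0 (-1)) -fg -RintegralZl//.
    by apply: eq_Rintegral => t _; rewrite mulN1r mulNr.
  exact/within_integrable/continuous_withinM.
rewrite -oppr_le0; apply: (fourier_coefficients_le0 (fun t => - f t)) => //.
- by move=> x; apply: cvgN; exact: cf.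
- by move=> m; apply: opp.
- by move=> m; apply: opp.
Qed.

(** The peaking argument reaches interior points only. As [f] is not assumed periodic, each endpoint
    value is recovered as a one-sided limit of zeros. *)
Lemma trigonometric_coefficients_eq0 (f : R -> R) :
  {within I, continuous f} ->
  (forall m : int, \int[mu]_(t in I) (f t * cos (m%:~R * t * h)) = 0)%R ->
  (forall m : int, \int[mu]_(t in I) (f t * sin (m%:~R * t * h)) = 0)%R ->
  forall t, I t -> f t = 0.
Proof.
move=> cf fcos fsin t; rewrite /= in_itv/= => /andP[].
have inner := fourier_coefficients_eq0_interior f _ cf fcos fsin.
have NLL : - L < L by have := L0; lra.
have [_ fL fR] := (continuous_within_itvP f NLL).1 cf.
rewrite le_eqVlt => /predU1P[<- _|Lt].
  rewrite -(cvg_lim _ fL)//; apply: cvg_lim => //; apply: cvg_near_cst.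
  near=> x; apply: inner; apply/andP; split; near: x.
    exact: nbhs_right_gt.
  exact: nbhs_right_lt.
rewrite le_eqVlt => /predU1P[->|tL]; last by apply: inner; rewrite Lt.
rewrite -(cvg_lim _ fR)//; apply: cvg_lim => //; apply: cvg_near_cst.
near=> x; apply: inner; apply/andP; split; near: x.
  exact: nbhs_left_gt.
exact: nbhs_left_lt.
Unshelve. all: by end_near. Qed.

End trigonometric_uniqueness.

(** * Complex-valued integrals and Fourier coefficients on an interval *)

Section complex_coefficients.
Variable R : realType.
Local Notation mu := (@lebesgue_measure R).
Implicit Types (x y : R[i]) (f g : R -> R[i]) (a b : R).

Lemma complex_ReM x y :
  complex.Re (x * y) = complex.Re x * complex.Re y - complex.Im x * complex.Im y.
Proof. by case: x; case: y. Qed.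

Lemma complex_ImM x y :
  complex.Im (x * y) = complex.Re x * complex.Im y + complex.Im x * complex.Re y.
Proof. by case: x; case: y. Qed.

Lemma eq_complexP x y : complex.Re x = complex.Re y -> complex.Im x = complex.Im y -> x = y.
Proof. by case: x y => [? ?] [? ?] /= -> ->. Qed.

Lemma cexpiD (s t : R) : cexpi (s + t) = cexpi s * cexpi t.
Proof.
apply: eq_complexP; rewrite ?complex_ReM ?complex_ImM /= ?cosD ?sinD //; ring.
Qed.

Let within_integrable a b (u : R -> R) :
  {within `[a, b]%classic, continuous u} -> mu.-integrable `[a, b] (EFin \o u).
Proof. by apply: continuous_compact_integrable; exact: segment_compact. Qed.

Definition ccontinuous_itv a b f :=
  {within `[a, b]%classic, continuous (fun t => complex.Re (f t))} /\
  {within `[a, b]%classic, continuous (fun t => complex.Im (f t))}.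

Lemma eq_cintegral a b f g : (forall t, a <= t <= b -> f t = g t) ->
  cintegral a b f = cintegral a b g.
Proof.
move=> fg; congr (_ +i* _); apply: eq_Rintegral => t;
  by rewrite inE/= in_itv/= => /fg ->.
Qed.

Lemma cintegralD a b f g : ccontinuous_itv a b f -> ccontinuous_itv a b g ->
  cintegral a b (fun t => f t + g t) = cintegral a b f + cintegral a b g.
Proof.
have ReD x y : complex.Re (x + y) = complex.Re x + complex.Re y by case: x; case: y.
have ImD x y : complex.Im (x + y) = complex.Im x + complex.Im y by case: x; case: y.
move=> [fr fi] [gr gi]; apply: eq_complexP; rewrite ?ReD ?ImD /=.
  rewrite -RintegralD//; [|exact: within_integrable..].
  by apply: eq_Rintegral => t _; rewrite ReD.
rewrite -RintegralD//; [|exact: within_integrable..].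
by apply: eq_Rintegral => t _; rewrite ImD.
Qed.

Lemma cintegralZr a b f x : ccontinuous_itv a b f ->
  cintegral a b (fun t => f t * x) = cintegral a b f * x.
Proof.
move=> [fr fi]; have ir := within_integrable a b _ fr.
have ii := within_integrable a b _ fi.
have sc (k : R) (z : R -> R) : mu.-integrable `[a, b] (EFin \o z) ->
    mu.-integrable `[a, b] (EFin \o (fun t => z t * k)).
  by move=> iz; exact: (integrableZr _ k iz).
apply: eq_complexP; rewrite ?complex_ReM ?complex_ImM /=.
  rewrite -!RintegralZr// -(RintegralB _ (sc _ _ ir) (sc _ _ ii))//.
  by apply: eq_Rintegral => t _; rewrite complex_ReM.
rewrite -!RintegralZr// -(RintegralD _ (sc _ _ ir) (sc _ _ ii))//.
by apply: eq_Rintegral => t _; rewrite complex_ImM.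
Qed.

(** Each complex coefficient mixes the real coefficients of [Re f] and [Im f]. Since cosine is even
    and sine odd in the frequency, the equations at [m] and [- m] together separate all four. *)
Lemma fourier_coefficients_eq0 (h : R) f : 0 < h ->
  ccontinuous_itv (- (pi / h)) (pi / h) f ->
  (forall m : int, cintegral (- (pi / h)) (pi / h)
     (fun t => f t * cexpi (m%:~R * t * h)) = 0) ->
  forall t, - (pi / h) <= t <= pi / h -> f t = 0.
Proof.
move=> h0 [fr fi] f0 t tI.
pose I : set R := `[- (pi / h), pi / h]%classic.
have ctrig (z : R -> R) (m : int) : {within I, continuous z} ->
    mu.-integrable I (EFin \o (fun t => z t * cos (m%:~R * t * h))) /\
    mu.-integrable I (EFin \o (fun t => z t * sin (m%:~R * t * h))).
  move=> cz.
  have cl : continuous (fun t : R => m%:~R * t * h).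
    move=> s; apply: cvgM; last exact: cvg_cst.
    by apply: cvgM; [exact: cvg_cst|exact: cvg_id].
  split; apply: within_integrable => s; apply: cvgM; first exact: cz.
  - have : continuous (fun t : R => cos (m%:~R * t * h)).
      by move=> r; apply: (@continuous_comp _ _ _ (fun t : R => m%:~R * t * h) cos);
       [exact: cl|exact: continuous_cos].
    by move/continuous_subspaceT; apply.
  - exact: cz.
  - have : continuous (fun t : R => sin (m%:~R * t * h)).
      by move=> r; apply: (@continuous_comp _ _ _ (fun t : R => m%:~R * t * h) sin);
       [exact: cl|exact: continuous_sin].
    by move/continuous_subspaceT; apply.
have mI : measurable (I : set (measurableTypeR R)) by exact: measurable_itv.
pose u t := complex.Re (f t); pose v t := complex.Im (f t).
pose uc m := (\int[mu]_(t in I) (u t * cos (m%:~R * t * h)))%R.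
pose us m := (\int[mu]_(t in I) (u t * sin (m%:~R * t * h)))%R.
pose vc m := (\int[mu]_(t in I) (v t * cos (m%:~R * t * h)))%R.
pose vs m := (\int[mu]_(t in I) (v t * sin (m%:~R * t * h)))%R.
have H1 m : uc m - vs m = 0.
  have := congr1 (@complex.Re R) (f0 m) => /= <-.
  rewrite -(RintegralB mI (ctrig u m fr).1 (ctrig v m fi).2).
  by apply: eq_Rintegral => s _; rewrite complex_ReM.
have H2 m : us m + vc m = 0.
  have := congr1 (@complex.Im R) (f0 m) => /= <-.
  rewrite -(RintegralD mI (ctrig u m fr).2 (ctrig v m fi).1).
  by apply: eq_Rintegral => s _; rewrite complex_ImM.
have neg (m : int) s : (- m)%:~R * s * h = - (m%:~R * s * h).
  by rewrite rmorphN/= !mulNr.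
have ucN m : uc (- m) = uc m.
  by apply: eq_Rintegral => s _; rewrite neg cosN.
have vcN m : vc (- m) = vc m.
  by apply: eq_Rintegral => s _; rewrite neg cosN.
have usN m : us (- m) = - us m.
  rewrite -[RHS]mulN1r /us -(RintegralZl _ mI (ctrig u m fr).2).
  by apply: eq_Rintegral => s _; rewrite neg sinN mulrN mulN1r.
have vsN m : vs (- m) = - vs m.
  rewrite -[RHS]mulN1r /vs -(RintegralZl _ mI (ctrig v m fi).2).
  by apply: eq_Rintegral => s _; rewrite neg sinN mulrN mulN1r.
have H m : [/\ uc m = 0, us m = 0, vc m = 0 & vs m = 0].
  have := H1 m; have := H2 m; have := H1 (- m); have := H2 (- m).
  by rewrite ucN usN vcN vsN => *; split; lra.
have tI' : I t by rewrite /I/= in_itv/=.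
apply: eq_complexP => /=.
  by apply: (trigonometric_coefficients_eq0 R h h0 u fr) => // m; case: (H m).
by apply: (trigonometric_coefficients_eq0 R h h0 v fi) => // m; case: (H m).
Qed.

End complex_coefficients.

Arguments ccontinuous_itv {R} a b f.

Lemma continuous_pair (T U V : topologicalType) (f : T -> U) (g : T -> V) :
  continuous f -> continuous g -> continuous (fun x => (f x, g x)).
Proof.
move=> cf cg x.
exact: (@cvg_pair _ _ _ (nbhs x) (nbhs (f x)) (nbhs (g x)) _ _ _ f g (cf x) (cg x)).
Qed.

(** * Continuity of slices and partial integrals on a rectangle *)

Section rectangle.
Variables (R : realType) (a b : R).
Hypotheses (a0 : 0 < a) (b0 : 0 < b).
Local Notation mu := (@lebesgue_measure R).
Let box : set (R * R) := `[- a, a]%classic `*` `[- b, b]%classic.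
Implicit Type u : R -> R -> R.

Definition clamp (c x : R) : R := Num.max (- c) (Num.min c x).

Let clamp_itv c x : 0 < c -> - c <= clamp c x <= c.
Proof. by move=> c0; rewrite /clamp le_max lexx ge_max ge_min lexx/= andbT; lra. Qed.

Let clamp_id c x : - c <= x <= c -> clamp c x = x.
Proof. by case/andP => cx xc; rewrite /clamp (min_idPr xc) (max_idPr cx). Qed.

Let continuous_clamp c : continuous (clamp c).
Proof.
move=> x; apply: (@continuous_max _ _ (fun=> - c) (Num.min c)); first exact: cvg_cst.
by apply: (@continuous_min _ _ (fun=> c) id); [exact: cvg_cst|exact: cvg_id].
Qed.

(* Composing with the retraction onto the rectangle turns relative continuity
   into global continuity. *)
Let continuous_extension u :
  {within box, continuous (fun p : R * R => u p.1 p.2)} ->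
  continuous (fun p : R * R => u (clamp a p.1) (clamp b p.2)).
Proof.
move=> cu p; pose r (p : R * R) := (clamp a p.1, clamp b p.2).
have rbox q : box (r q) by split; rewrite /= in_itv/= clamp_itv.
have cr : continuous r.
  apply: continuous_pair => q.
    by apply: (@continuous_comp _ _ _ fst (clamp a)); [exact: cvg_fst|exact: continuous_clamp].
  by apply: (@continuous_comp _ _ _ snd (clamp b)); [exact: cvg_snd|exact: continuous_clamp].
have /subspace_continuousP/(_ _ (rbox p)) cup := cu.
have rp : r @ p --> within box (nbhs (r p)).
  move=> A /= wA.
  have H : nbhs p (r @^-1` [set q | box q -> A q]) := cr p _ wA.
  by apply: filterS H => q /=; apply; exact: (rbox q).
exact: (cvg_comp _ _ rp cup).
Qed.

Let bounded_extension u :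
  {within box, continuous (fun p : R * R => u p.1 p.2)} ->
  exists M, forall x y, `|u (clamp a x) (clamp b y)| <= M.
Proof.
move=> cu.
have cbox : compact box by apply: compact_setX; exact: segment_compact.
have /compact_bounded[M [_ HM]] := continuous_compact cu cbox.
exists (`|M| + 1) => x y; apply: (HM (`|M| + 1)).
  by rewrite (le_lt_trans (ler_norm M))// ltrDl.
by exists (clamp a x, clamp b y) => //; split; rewrite /= in_itv/= clamp_itv.
Qed.

Lemma continuous_slice u (y : R) : - b <= y <= b ->
  {within box, continuous (fun p : R * R => u p.1 p.2)} ->
  {within `[- a, a]%classic, continuous (u ^~ y)}.
Proof.
move=> yb cu.
have ce : continuous (fun x => u (clamp a x) (clamp b y)).
  move=> x; apply: (@continuous_comp _ _ _ (fun x : R => (x, y)) _ x _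
    (continuous_extension u cu (x, y))).
  by apply: continuous_pair => z; [exact: cvg_id|exact: cvg_cst].
apply: (subspace_eq_continuous _ (continuous_subspaceT ce)).
by move=> x; rewrite inE/= in_itv/= => xa; rewrite (clamp_id b)// /from_subspace (clamp_id a).
Qed.

Lemma continuous_slice_integral u :
  {within box, continuous (fun p : R * R => u p.1 p.2)} ->
  {within `[- b, b]%classic, continuous (fun y => \int[mu]_(x in `[- a, a]) u x y)%R}.
Proof.
move=> cu; have ce := continuous_extension u cu.
have [M HM] := bounded_extension u cu.
have iM : mu.-integrable `[- a, a] (EFin \o (fun _ : R => M)).
  apply: continuous_compact_integrable; first exact: segment_compact.
  by move=> x; exact: cvg_cst.
(* Continuity under the integral is obtained on an open interval. The clamped integrand is defined
   and bounded everywhere, so the interval can be enlarged to contain the closed one. *)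
have H : {in `]- (b + 1), b + 1[%classic, continuous
    (fun y => \int[mu]_(x in `[- a, a]) u (clamp a x) (clamp b y))%R}.
  have mI : measurable (`[- a, a]%classic : set (measurableTypeR R)) by exact: measurable_itv.
  have := @continuity_under_integral R _ (measurableTypeR R) mu
    (fun y x => u (clamp a x) (clamp b y)) _ mI (- (b + 1)) (b + 1) _ _ (fun=> M). apply => //.
  - move=> y _; apply: continuous_compact_integrable; first exact: segment_compact.
    apply: continuous_subspaceT => x.
    apply: (@continuous_comp _ _ _ (fun x : R => (x, y)) _ x _ (ce (x, y))).
    by apply: continuous_pair => z; [exact: cvg_id|exact: cvg_cst].
  - apply: aeW => x _ y _.
    apply: (@continuous_comp _ _ _ (fun y : R => (x, y)) _ y _ (ce (x, y))).
    by apply: continuous_pair => z; [exact: cvg_cst|exact: cvg_id].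
  - by move=> y _; apply: aeW => x _; exact: HM.
have H' : {within `[- b, b]%classic, continuous
    (fun y => \int[mu]_(x in `[- a, a]) u (clamp a x) (clamp b y))%R}.
  apply/subspace_continuousP => y; rewrite /= in_itv/= => yb.
  apply: cvg_within_filter; apply: H.
  by rewrite inE/= in_itv/=; case/andP: yb => ? ?; apply/andP; split; lra.
apply: (subspace_eq_continuous _ H') => y; rewrite inE/= in_itv/= => yb.
apply: eq_Rintegral => x; rewrite inE/= in_itv/= => xa.
by rewrite (clamp_id b)// (clamp_id a).
Qed.

End rectangle.

(** * Discrete Fourier transform *)

Section discrete_fourier_transform.
Variables (R : realType) (hx hy : R).
Hypotheses (hx0 : 0 < hx) (hy0 : 0 < hy).
Local Notation mu := (@lebesgue_measure R).
Local Notation Lx := (pi / hx).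
Local Notation Ly := (pi / hy).
Implicit Types (X Y : R -> R -> R[i]) (V W : grid R).

Definition ccontinuous_box X :=
  {within freq_box hx hy, continuous (fun p : R * R => complex.Re (X p.1 p.2))} /\
  {within freq_box hx hy, continuous (fun p : R * R => complex.Im (X p.1 p.2))}.

Let J X := cintegral (- Ly) Ly (fun eta => cintegral (- Lx) Lx (fun xi => X xi eta)).

Let Lx0 : 0 < Lx. Proof. by rewrite divr_gt0// pi_gt0. Qed.
Let Ly0 : 0 < Ly. Proof. by rewrite divr_gt0// pi_gt0. Qed.

Let ReD (x y : R[i]) : complex.Re (x + y) = complex.Re x + complex.Re y.
Proof. by case: x; case: y. Qed.

Let ImD (x y : R[i]) : complex.Im (x + y) = complex.Im x + complex.Im y.
Proof. by case: x; case: y. Qed.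

Lemma ccontinuous_boxD X Y : ccontinuous_box X -> ccontinuous_box Y ->
  ccontinuous_box (fun xi eta => X xi eta + Y xi eta).
Proof.
move=> [Xr Xi] [Yr Yi]; split.
  under eq_fun do rewrite ReD.
  by move=> p; apply: cvgD; [exact: Xr|exact: Yr].
under eq_fun do rewrite ImD.
by move=> p; apply: cvgD; [exact: Xi|exact: Yi].
Qed.

Lemma ccontinuous_boxM X Y : ccontinuous_box X -> ccontinuous_box Y ->
  ccontinuous_box (fun xi eta => X xi eta * Y xi eta).
Proof.
move=> [Xr Xi] [Yr Yi]; split.
  under eq_fun do rewrite complex_ReM.
  move=> p; apply: cvgB; apply: cvgM;
   [exact: Xr|exact: Yr|exact: Xi|exact: Yi].
under eq_fun do rewrite complex_ImM.
move=> p; apply: cvgD; apply: cvgM;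
 [exact: Xr|exact: Yi|exact: Xi|exact: Yr].
Qed.

Lemma ccontinuous_box_cst (c : R[i]) : ccontinuous_box (fun _ _ => c).
Proof. by split => p; exact: cvg_cst. Qed.

Let cexpi_continuous (f : R * R -> R) : continuous f ->
  {within freq_box hx hy, continuous (cos \o f)} /\
  {within freq_box hx hy, continuous (sin \o f)}.
Proof.
move=> cf; split; apply: continuous_subspaceT => p.
  by apply: continuous_comp; [exact: cf|exact: continuous_cos].
by apply: continuous_comp; [exact: cf|exact: continuous_sin].
Qed.

Lemma ccontinuous_box_cexpi (a b : R) :
  ccontinuous_box (fun xi eta => cexpi (a * xi * hx + b * eta * hy)).
Proof.
have cf : continuous (fun p : R * R => a * p.1 * hx + b * p.2 * hy).
  move=> p; apply: cvgD; apply: cvgM; try exact: cvg_cst;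
  apply: cvgM; try exact: cvg_cst; [exact: cvg_fst|exact: cvg_snd].
by have [] := cexpi_continuous _ cf.
Qed.

Lemma ccontinuous_box_slice X (eta : R) : - Ly <= eta <= Ly -> ccontinuous_box X ->
  ccontinuous_itv (- Lx) Lx (X ^~ eta).
Proof.
move=> eL [Xr Xi]; split.
  exact: (continuous_slice _ Lx Ly Lx0 Ly0 (fun x y => complex.Re (X x y)) _ eL Xr).
exact: (continuous_slice _ Lx Ly Lx0 Ly0 (fun x y => complex.Im (X x y)) _ eL Xi).
Qed.

Lemma ccontinuous_box_integral X : ccontinuous_box X ->
  ccontinuous_itv (- Ly) Ly (fun eta => cintegral (- Lx) Lx (X ^~ eta)).
Proof.
move=> [Xr Xi]; split.
  exact: (continuous_slice_integral _ Lx Ly Lx0 Ly0 (fun x y => complex.Re (X x y)) Xr).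
exact: (continuous_slice_integral _ Lx Ly Lx0 Ly0 (fun x y => complex.Im (X x y)) Xi).
Qed.

Let eq_J X Y :
  (forall xi eta, - Lx <= xi <= Lx -> - Ly <= eta <= Ly -> X xi eta = Y xi eta) ->
  J X = J Y.
Proof.
by move=> XY; apply: eq_cintegral => eta etaL; apply: eq_cintegral => xi xiL; exact: XY.
Qed.

Let JD X Y : ccontinuous_box X -> ccontinuous_box Y ->
  J (fun xi eta => X xi eta + Y xi eta) = J X + J Y.
Proof.
move=> cX cY; rewrite /J -cintegralD; [|exact: ccontinuous_box_integral..].
apply: eq_cintegral => eta etaL.
by rewrite -cintegralD//; exact: ccontinuous_box_slice.
Qed.

Let JZr X (c : R[i]) : ccontinuous_box X -> J (fun xi eta => X xi eta * c) = J X * c.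
Proof.
move=> cX; rewrite /J -cintegralZr; last exact: ccontinuous_box_integral.
apply: eq_cintegral => eta etaL.
by rewrite -cintegralZr//; exact: ccontinuous_box_slice.
Qed.

(** For fixed [m], the partial transform in [xi] is a continuous function of [eta] with vanishing
    coefficients, hence zero. Every slice in [xi] then has vanishing coefficients too. *)
Lemma fourier_coefficients_box_eq0 X : ccontinuous_box X ->
  (forall m l : int, J (fun xi eta => X xi eta * cexpi (m%:~R * xi * hx + l%:~R * eta * hy)) = 0) ->
  forall xi eta, freq_box hx hy (xi, eta) -> X xi eta = 0.
Proof.
move=> cX H xi eta [/=]; rewrite !in_itv/= => xiL etaL.
have cXe (m : int) : ccontinuous_box (fun xi eta => X xi eta * cexpi (m%:~R * xi * hx)).
  apply: ccontinuous_boxM => //.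
  have := ccontinuous_box_cexpi m%:~R 0.
  by under [X in ccontinuous_box X]eq_fun do under eq_fun do rewrite !mul0r addr0.
apply: (fourier_coefficients_eq0 R hx (X ^~ eta) hx0) => //.
  exact: ccontinuous_box_slice.
move=> m; pose G (eta : R) := cintegral (- Lx) Lx (fun xi => X xi eta * cexpi (m%:~R * xi * hx)).
apply: (fourier_coefficients_eq0 R hy G hy0) => //.
  exact: ccontinuous_box_integral.
move=> l; rewrite -[RHS](H m l); apply: eq_cintegral => y yL.
rewrite -cintegralZr; last exact: (ccontinuous_box_slice _ _ yL (cXe m)).
by apply: eq_cintegral => x _; rewrite cexpiD mulrA.
Qed.

Variables i0 j0 : int.
Local Notation dft := (is_dft hx hy i0 j0).
Local Notation K := ((4 * pi ^+ 2)^-1%:C : R[i]).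
Let E (i j : int) : R -> R -> R[i] := fun xi eta =>
  cexpi ((i - i0)%:~R * xi * hx + (j - j0)%:~R * eta * hy).

Let cE X i j : ccontinuous_box X -> ccontinuous_box (fun xi eta => X xi eta * E i j xi eta).
Proof. by move=> cX; apply: ccontinuous_boxM => //; exact: ccontinuous_box_cexpi. Qed.

Lemma is_dftD V W X Y : dft V X -> dft W Y ->
  dft (fun i j => V i j + W i j) (fun xi eta => X xi eta + Y xi eta).
Proof.
move=> [Xr [Xi VX]] [Yr [Yi WY]].
have [Zr Zi] := ccontinuous_boxD X Y (conj Xr Xi) (conj Yr Yi).
split; first exact: Zr.
split; first exact: Zi.
move=> i j; rewrite rmorphD/= VX WY -mulrDr; apply: (congr1 (fun z => K * z)).
rewrite -[LHS](JD _ _ (cE X i j (conj Xr Xi)) (cE Y i j (conj Yr Yi))).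
by apply: eq_J => xi eta _ _; rewrite mulrDl.
Qed.

Lemma is_dftZ V X (c : R) : dft V X ->
  dft (fun i j => c * V i j) (fun xi eta => c%:C * X xi eta).
Proof.
move=> [Xr [Xi VX]].
have [Zr Zi] := ccontinuous_boxM _ X (ccontinuous_box_cst c%:C) (conj Xr Xi).
split; first exact: Zr.
split; first exact: Zi.
move=> i j; rewrite rmorphM/= VX mulrCA; apply: (congr1 (fun z => K * z)).
rewrite mulrC -[LHS](JZr _ _ (cE X i j (conj Xr Xi))).
by apply: eq_J => xi eta _ _; rewrite mulrC mulrA.
Qed.

Lemma is_dft_shift V X (m l : int) : dft V X ->
  dft (fun i j => V (i + m) (j + l))
    (fun xi eta => X xi eta * cexpi (m%:~R * xi * hx + l%:~R * eta * hy)).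
Proof.
move=> [Xr [Xi VX]].
have [Zr Zi] := ccontinuous_boxM X _ (conj Xr Xi) (ccontinuous_box_cexpi m%:~R l%:~R).
split; first exact: Zr.
split; first exact: Zi.
move=> i j; rewrite VX; apply: (congr1 (fun z => K * z)).
apply: eq_J => xi eta _ _; rewrite -[RHS]mulrA -cexpiD; congr (_ * cexpi _).
by rewrite !rmorphB !rmorphD/=; ring.
Qed.

Lemma eq_is_dft V W X Y : dft V X -> V = W ->
  (forall xi eta, X xi eta = Y xi eta) -> dft W Y.
Proof.
move=> VX <- XY; rewrite (_ : Y = X)//.
by apply/funext => xi; apply/funext => eta; rewrite XY.
Qed.

Lemma is_dft_unique V X Y : dft V X -> dft V Y ->
  forall xi eta, freq_box hx hy (xi, eta) -> X xi eta = Y xi eta.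
Proof.
move=> VX VY xi eta box; apply/eqP; rewrite -subr_eq0; apply/eqP.
have [Zr [Zi Z]] := is_dftD _ _ _ _ VX (is_dftZ _ _ (-1) VY).
rewrite -[LHS](_ : X xi eta + (-1)%:C * Y xi eta = _); last first.
  by rewrite rmorphN1 mulN1r.
apply: (fourier_coefficients_box_eq0 (fun xi eta => X xi eta + (-1)%:C * Y xi eta)) => // m l.
(* The grid point [(m + i0, l + j0)] undoes the centring of the transform, so that frequency
   [(m, l)] appears. *)
have := Z (m + i0) (l + j0); rewrite mulN1r subrr rmorph0 !addrK => /esym/eqP.
rewrite mulf_eq0 => /orP[|/eqP//].
rewrite eq_complex/= invr_eq0 mulf_eq0 expf_eq0 /= (gt_eqF (pi_gt0 R)).
by rewrite pnatr_eq0.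
Qed.

End discrete_fourier_transform.

Arguments is_dftD {R hx hy} hx0 hy0 {i0 j0 V W X Y}.
Arguments is_dftZ {R hx hy} hx0 hy0 {i0 j0 V X} c.
Arguments is_dft_shift {R hx hy i0 j0 V X} m l.
Arguments eq_is_dft {R hx hy i0 j0 V W X Y}.
Arguments is_dft_unique {R hx hy} hx0 hy0 {i0 j0 V X Y}.

(** * Symbols of the scheme *)

Section symbols.
Context {R : realType} {hx hy : R} {i0 j0 : int}.
Hypotheses (hx0 : 0 < hx) (hy0 : 0 < hy).
Local Notation dft := (is_dft hx hy i0 j0).

Lemma is_dft_Dx {V : grid R} {X} : dft V X ->
  dft (Dx V) (fun xi eta => X xi eta * (0 +i* (2 * sin (xi * hx)))).
Proof.
move=> VX; have VX1 := is_dft_shift 1 0 VX.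
have VX2 := is_dft_shift (-1) 0 VX.
apply: (eq_is_dft
  (is_dftD hx0 hy0 VX1 (is_dftZ hx0 hy0 (-1) VX2))).
  by apply/funext => i; apply/funext => j; rewrite /Dx !addr0 mulN1r.
move=> xi eta; rewrite !mul0r !addr0 mul1r mulN1r mulNr /cexpi cosN sinN.
by case: (X xi eta) => u v; apply: eq_complexP => /=; ring.
Qed.

Lemma is_dft_Dy {V : grid R} {X} : dft V X ->
  dft (Dy V) (fun xi eta => X xi eta * (0 +i* (2 * sin (eta * hy)))).
Proof.
move=> VX; have VX1 := is_dft_shift 0 1 VX.
have VX2 := is_dft_shift 0 (-1) VX.
apply: (eq_is_dft
  (is_dftD hx0 hy0 VX1 (is_dftZ hx0 hy0 (-1) VX2))).
  by apply/funext => i; apply/funext => j; rewrite /Dy !addr0 mulN1r.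
move=> xi eta; rewrite !mul0r !add0r mul1r mulN1r mulNr /cexpi cosN sinN.
by case: (X xi eta) => u v; apply: eq_complexP => /=; ring.
Qed.

Lemma is_dft_Dxx {V : grid R} {X} : dft V X ->
  dft (Dxx V) (fun xi eta => X xi eta * (2 * cos (xi * hx) - 2)%:C).
Proof.
move=> VX; have VX1 := is_dft_shift 1 0 VX.
have VX2 := is_dft_shift (-1) 0 VX.
apply: (eq_is_dft
  (is_dftD hx0 hy0 (is_dftD hx0 hy0 VX1 VX2)
   (is_dftZ hx0 hy0 (-2) VX))).
  by apply/funext => i; apply/funext => j; rewrite /Dxx !addr0; ring.
move=> xi eta; rewrite !mul0r !addr0 mul1r mulN1r mulNr /cexpi cosN sinN.
by case: (X xi eta) => u v; apply: eq_complexP => /=; ring.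
Qed.

Lemma is_dft_Dyy {V : grid R} {X} : dft V X ->
  dft (Dyy V) (fun xi eta => X xi eta * (2 * cos (eta * hy) - 2)%:C).
Proof.
move=> VX; have VX1 := is_dft_shift 0 1 VX.
have VX2 := is_dft_shift 0 (-1) VX.
apply: (eq_is_dft
  (is_dftD hx0 hy0 (is_dftD hx0 hy0 VX1 VX2)
   (is_dftZ hx0 hy0 (-2) VX))).
  by apply/funext => i; apply/funext => j; rewrite /Dyy !addr0; ring.
move=> xi eta; rewrite !mul0r !add0r mul1r mulN1r mulNr /cexpi cosN sinN.
by case: (X xi eta) => u v; apply: eq_complexP => /=; ring.
Qed.

Lemma is_dft_Dxy {V : grid R} {X} : dft V X ->
  dft (Dxy V) (fun xi eta => X xi eta * (- (4 * sin (xi * hx) * sin (eta * hy)))%:C).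
Proof.
move=> VX; apply: (eq_is_dft (is_dft_Dx (is_dft_Dy VX))).
  by apply/funext => i; apply/funext => j; rewrite /Dxy /Dx /Dy; ring.
move=> xi eta.
by case: (X xi eta) => u v; apply: eq_complexP => /=; ring.
Qed.

Definition implicit_symbol (mux muy k xi eta : R) : R[i] :=
  (1 + (k / hx ^+ 2 * (1 - cos (xi * hx)) + k / hy ^+ 2 * (1 - cos (eta * hy))))
  +i* (mux * k / hx * sin (xi * hx) + muy * k / hy * sin (eta * hy)).

Definition explicit_symbol (rhox rhoy k zx zty xi eta : R) : R[i] :=
  (1 - rhox * k * (zx ^+ 2 - 1) / (2 * hx ^+ 2) * sin (xi * hx) ^+ 2
     - rhoy * k * (zty ^+ 2 - 1) / (2 * hy ^+ 2) * sin (eta * hy) ^+ 2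
     - Num.sqrt (rhox * rhoy) * k * zx * zty / (hx * hy)
       * sin (xi * hx) * sin (eta * hy))
  +i* (- (Num.sqrt (rhox * k) * zx / hx * sin (xi * hx)
          + Num.sqrt (rhoy * k) * zty / hy * sin (eta * hy))).

Let hx_neq0 : hx != 0. Proof. by rewrite gt_eqF. Qed.
Let hy_neq0 : hy != 0. Proof. by rewrite gt_eqF. Qed.

Lemma is_dft_implicit_operator mux muy k (V : grid R) X : dft V X ->
  dft (implicit_operator mux muy hx hy k V)
    (fun xi eta => implicit_symbol mux muy k xi eta * X xi eta).
Proof.
move=> VX.
have H := is_dftD hx0 hy0 (is_dftD hx0 hy0 (is_dftD hx0 hy0 (is_dftD hx0 hy0 VX
  (is_dftZ hx0 hy0 (mux * k / (2 * hx)) (is_dft_Dx VX)))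
  (is_dftZ hx0 hy0 (muy * k / (2 * hy)) (is_dft_Dy VX)))
  (is_dftZ hx0 hy0 (- (k / (2 * hx ^+ 2))) (is_dft_Dxx VX)))
  (is_dftZ hx0 hy0 (- (k / (2 * hy ^+ 2))) (is_dft_Dyy VX)).
apply: (eq_is_dft H).
  by apply/funext => i; apply/funext => j; rewrite /implicit_operator !mulNr.
move=> xi eta; case: (X xi eta) => u v.
by apply: eq_complexP => /=; field; rewrite hx_neq0 hy_neq0.
Qed.

Lemma is_dft_explicit_operator rhox rhoy k zx zty (V : grid R) X : dft V X ->
  dft (explicit_operator rhox rhoy hx hy k zx zty V)
    (fun xi eta => explicit_symbol rhox rhoy k zx zty xi eta * X xi eta).
Proof.
move=> VX.
have H := is_dftD hx0 hy0 (is_dftD hx0 hy0 (is_dftD hx0 hy0 (is_dftD hx0 hy0 (is_dftD hx0 hy0 VX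
  (is_dftZ hx0 hy0 (- (Num.sqrt (rhox * k) * zx / (2 * hx))) (is_dft_Dx VX)))
  (is_dftZ hx0 hy0 (- (Num.sqrt (rhoy * k) * zty / (2 * hy))) (is_dft_Dy VX)))
  (is_dftZ hx0 hy0 (rhox * k * (zx ^+ 2 - 1) / (8 * hx ^+ 2)) (is_dft_Dx (is_dft_Dx VX))))
  (is_dftZ hx0 hy0 (rhoy * k * (zty ^+ 2 - 1) / (8 * hy ^+ 2)) (is_dft_Dy (is_dft_Dy VX))))
  (is_dftZ hx0 hy0 (Num.sqrt (rhox * rhoy) * k * zx * zty / (4 * hx * hy)) (is_dft_Dxy VX)).
apply: (eq_is_dft H).
  by apply/funext => i; apply/funext => j; rewrite /explicit_operator !mulNr.
move=> xi eta; case: (X xi eta) => u v.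
by apply: eq_complexP => /=; field; rewrite hx_neq0 hy_neq0.
Qed.

End symbols.

Arguments implicit_symbol {R} hx hy mux muy k xi eta.
Arguments explicit_symbol {R} hx hy rhox rhoy k zx zty xi eta.

(** * Moduli of the symbols *)

Lemma sqr_normc (R : realType) (x y : R) : Normc.normc (x +i* y) ^+ 2 = x ^+ 2 + y ^+ 2.
Proof. by rewrite /= sqr_sqrtr// addr_ge0// sqr_ge0. Qed.

Lemma cos_lt1 (R : realType) (x : R) : x != 0 -> `|x| <= pi -> cos x < 1.
Proof.
move=> x0 xpi; rewrite -cos_norm -[ltRHS]cos0 ltr_cos ?in_itv/= ?lexx ?pi_ge0//.
- by rewrite normr_gt0.
- by rewrite normr_ge0.
Qed.

Lemma sqr_normc_explicit_symbol (R : realType) (rhox rhoy rhoxy hx hy k zx zy xi eta : R) :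
  0 <= rhox -> 0 <= rhoy -> 0 < hx -> 0 < hy -> 0 < k ->
  let p := Num.sqrt (rhox * k) / hx * sin (xi * hx) in
  let q := Num.sqrt (rhoy * k) / hy * sin (eta * hy) in
  let W := (p + q * rhoxy) * zx + q * Num.sqrt (1 - rhoxy ^+ 2) * zy in
  Normc.normc (explicit_symbol hx hy rhox rhoy k zx (correlated rhoxy zx zy) xi eta) ^+ 2
  = W ^+ 2 + (1 + (p ^+ 2 + q ^+ 2) / 2 - W ^+ 2 / 2) ^+ 2.
Proof.
move=> rx0 ry0 hx0 hy0 k0 p q W; rewrite /explicit_symbol sqr_normc /W /p /q.
have hx1 : hx != 0 by rewrite gt_eqF.
have hy1 : hy != 0 by rewrite gt_eqF.
have rxk : Num.sqrt (rhox * k) ^+ 2 = rhox * k.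
  by rewrite sqr_sqrtr// mulr_ge0// ltW.
have ryk : Num.sqrt (rhoy * k) ^+ 2 = rhoy * k.
  by rewrite sqr_sqrtr// mulr_ge0// ltW.
(* This factorisation turns the coefficient of the [D_xy] term into [p q], which completes the
   square in [W]. *)
have rxy : Num.sqrt (rhox * rhoy) * k = Num.sqrt (rhox * k) * Num.sqrt (rhoy * k).
  rewrite -sqrtrM ?mulr_ge0// ?ltW// (_ : rhox * k * (rhoy * k) = rhox * rhoy * k ^+ 2).
    by rewrite [in RHS]sqrtrM ?mulr_ge0// sqrtr_sqr gtr0_norm.
  by ring.
rewrite rxy /correlated.
move: rxk ryk; set sx := Num.sqrt (rhox * k); set sy := Num.sqrt (rhoy * k).
set rr := Num.sqrt (1 - rhoxy ^+ 2) => rxk ryk; rewrite -rxk -ryk.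
by field; rewrite hx1 hy1.
Qed.

(** The drift enters only the imaginary part, so it can only enlarge the modulus. *)
Lemma sqr_normc_implicit_symbol_ge (R : realType) (mux muy hx hy k xi eta : R) :
  0 < hx -> 0 < hy -> 0 < k ->
  (1 + (k / hx ^+ 2 * (1 - cos (xi * hx)) + k / hy ^+ 2 * (1 - cos (eta * hy)))) ^+ 2
  <= Normc.normc (implicit_symbol hx hy mux muy k xi eta) ^+ 2.
Proof. by move=> *; rewrite sqr_normc lerDl sqr_ge0. Qed.

(** [sin^2 = (1 - cos) (1 + cos)], and the slack is a multiple of [(1 - cos)^2]. Both sides are
    proportional to [k / h^2], which is why no condition relates the time step to the grid. *)
Lemma sqr_sin_symbol_le (R : realType) (rho k h t : R) : 0 <= rho -> 0 < h -> 0 < k ->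
  (Num.sqrt (rho * k) / h * sin t) ^+ 2 <= 2 * rho * (k / h ^+ 2 * (1 - cos t)).
Proof.
have rk : 0 <= rho -> 0 < k -> 0 <= rho * k by move=> *; rewrite mulr_ge0// ltW.
move=> r0 h0 k0; rewrite exprMn exprMn (sqr_sqrtr (rk r0 k0)) exprVn sin2cos2.
have c1 := cos_le1 t.
have kh : 0 <= rho * (k / h ^+ 2) by rewrite mulr_ge0// divr_ge0 ?ltW// exprn_gt0.
rewrite -subr_ge0 (_ : _ - _ = rho * (k / h ^+ 2) * ((1 - cos t) * (1 - cos t))).
  by rewrite mulr_ge0// mulr_ge0// subr_ge0.
by ring.
Qed.

(** On the box both angles lie in [[-pi, pi]], where cosine equals 1 only at zero; this is where the
    zero frequency has to be excluded. *)
Lemma symbol_diffusion_gt0 (R : realType) (hx hy k xi eta : R) :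
  0 < hx -> 0 < hy -> 0 < k -> freq_box hx hy (xi, eta) -> (xi, eta) <> (0, 0) ->
  0 < k / hx ^+ 2 * (1 - cos (xi * hx)) + k / hy ^+ 2 * (1 - cos (eta * hy)).
Proof.
move=> hx0 hy0 k0 [/=]; rewrite !in_itv/= => xiL etaL nz.
have angle (h x : R) : 0 < h -> - (pi / h) <= x <= pi / h -> `|x * h| <= pi.
  move=> h0; rewrite -ler_norml normrM (gtr0_norm h0).
  by rewrite ler_pdivlMr.
have kx : 0 < k / hx ^+ 2 by rewrite divr_gt0// exprn_gt0.
have ky : 0 < k / hy ^+ 2 by rewrite divr_gt0// exprn_gt0.
have x0 : 0 <= k / hx ^+ 2 * (1 - cos (xi * hx)).
  by apply: mulr_ge0; [exact: ltW|rewrite subr_ge0 cos_le1].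
have y0 : 0 <= k / hy ^+ 2 * (1 - cos (eta * hy)).
  by apply: mulr_ge0; [exact: ltW|rewrite subr_ge0 cos_le1].
have [xi0|xi0] := eqVneq xi 0.
  have eta0 : eta != 0 by apply/eqP => eta0; apply: nz; rewrite xi0 eta0.
  apply: ltr_wpDl => //; rewrite mulr_gt0// subr_gt0 cos_lt1 ?angle//.
  by rewrite mulf_neq0// gt_eqF.
apply: ltr_pwDl => //; rewrite mulr_gt0// subr_gt0 cos_lt1 ?angle//.
by rewrite mulf_neq0// gt_eqF.
Qed.

(** * Mean-square decay of the Fourier coefficients *)

Theorem theorem3p1 (R : realType) (d : measure_display) (T : measurableType d)
  (P : probability T R) (mux muy rhox rhoy rhoxy : R) (i0 j0 : int)
  (hrhox : 0 <= rhox < 1) (hrhoy : 0 <= rhoy < 1) (hrhoxy : -1 <= rhoxy <= 1)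
  (hx_stable : 2 * rhox ^+ 2 * (1 + 2 * `|rhoxy|) < 1)
  (hy_stable : 2 * rhoy ^+ 2 * (1 + 2 * `|rhoxy|) < 1)
  (hxy_stable :
    2 * rhox * rhoy * (3 * rhoxy ^+ 2 + 2 * `|rhoxy| + 1) < 1)
  (Zx Zy : nat -> {RV P >-> R}) (hZ : gaussian_noise Zx Zy)
  (hx hy k : R) (hx_gt0 : 0 < hx) (hy_gt0 : 0 < hy) (k_gt0 : 0 < k)
  (V : nat -> T -> grid R)
  (hV : forall w : T,
    milstein_scheme mux muy rhox rhoy rhoxy hx hy k i0 j0
      (fun n => Zx n w) (fun n => Zy n w) (fun n => V n w))
  (X : nat -> T -> R -> R -> R[i])
  (hX0 : forall (w : T) (xi eta : R),
    freq_box hx hy (xi, eta) -> X 0%N w xi eta = 1)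
  (hX : forall (n : nat) (w : T), is_dft hx hy i0 j0 (V n w) (X n w))
  (xi eta : R) (hbox : freq_box hx hy (xi, eta))
  (hnz : (xi, eta) <> (0, 0)) :
  ('E_P[(fun w => Normc.normc (X n w xi eta) ^+ 2)%R])%E @[n --> \oo] --> 0%E.
Proof.
have /andP[rx0 rx1] := hrhox; have /andP[ry0 ry1] := hrhoy.
have /andP[rN1 r1] := hrhoxy.
pose al := k / hx ^+ 2 * (1 - cos (xi * hx)).
pose be := k / hy ^+ 2 * (1 - cos (eta * hy)).
pose p := Num.sqrt (rhox * k) / hx * sin (xi * hx).
pose q := Num.sqrt (rhoy * k) / hy * sin (eta * hy).
pose s := p ^+ 2 + q ^+ 2.
have al0 : 0 <= al.
  by apply: mulr_ge0; rewrite ?subr_ge0 ?cos_le1// divr_ge0 ?sqr_ge0// ltW.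
have be0 : 0 <= be.
  by apply: mulr_ge0; rewrite ?subr_ge0 ?cos_le1// divr_ge0 ?sqr_ge0// ltW.
have albe : 0 < al + be by exact: symbol_diffusion_gt0.
have estimate := mean_square_symbol_lt _ _ _ rhoxy _ _ p q hrhox hrhoy
  hx_stable hy_stable hxy_stable al0 be0 albe
  (sqr_sin_symbol_le _ rhox k hx _ rx0 hx_gt0 k_gt0)
  (sqr_sin_symbol_le _ rhoy k hy _ ry0 hy_gt0 k_gt0).
pose A := implicit_symbol hx hy mux muy k xi eta.
have A_ge : (1 + (al + be)) ^+ 2 <= Normc.normc A ^+ 2.
  exact: sqr_normc_implicit_symbol_ge.
have A0 : 0 < Normc.normc A ^+ 2.
  by apply: lt_le_trans A_ge; rewrite exprn_gt0// addr_gt0.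
pose c := p + q * rhoxy; pose e := 1 + s / 2.
pose dd := q * Num.sqrt (1 - rhoxy ^+ 2).
pose r := (Normc.normc A ^+ 2)^-1.
(* The squared modulus of the amplification factor as a function of the two independent noise
   values; [c] and [dd] are the coefficients of [W] in them, and [m] below is the mean of [g]. *)
pose g x y := r * ((c * x + dd * y) ^+ 2 + (e - (c * x + dd * y) ^+ 2 / 2) ^+ 2).
have r0 : 0 <= r by rewrite invr_ge0 ltW.
have g0 x y : 0 <= g x y by rewrite mulr_ge0// addr_ge0// sqr_ge0.
have mg : measurable_fun [set: R * R] (fun z => g z.1 z.2).
  have ml : measurable_fun [set: R * R] (fun z : R * R => (c * z.1 + dd * z.2) ^+ 2).
    apply: measurable_funX; apply: measurable_funD; apply: measurable_funM => //.
  apply: measurable_funM => //; apply: measurable_funD => //.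
  apply: measurable_funX; apply: measurable_funB => //; exact: measurable_funM.
pose m := r * ((1 - e) * (c ^+ 2 + dd ^+ 2) + e ^+ 2 + 3 / 4 * (c ^+ 2 + dd ^+ 2) ^+ 2).
have XS n w : Normc.normc (X n.+1 w xi eta) ^+ 2
    = g (Zx n w) (Zy n w) * Normc.normc (X n w xi eta) ^+ 2.
  have [_ scheme] := hV w; have [_ schemen] := scheme n.
  have D1 := is_dft_implicit_operator hx_gt0 hy_gt0 mux muy k _ _ (hX n.+1 w).
  have D2 := is_dft_explicit_operator hx_gt0 hy_gt0 rhox rhoy k (Zx n w)
    (correlated rhoxy (Zx n w) (Zy n w)) _ _ (hX n w).
  rewrite schemen in D1.
  have /(congr1 (fun z => Normc.normc z ^+ 2)) := is_dft_unique hx_gt0 hy_gt0 D1 D2 _ _ hbox.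
  rewrite !Normc.normcM !exprMn sqr_normc_explicit_symbol// -/A => AX.
  apply: (mulfI (lt0r_neq0 A0)); rewrite AX /g -(mulrA r).
  by rewrite [RHS]mulVKf// lt0r_neq0.
have Xprod n w : Normc.normc (X n w xi eta) ^+ 2 = \prod_(j < n) g (Zx j w) (Zy j w).
  elim: n => [|n IH]; last by rewrite big_ord_recr/= -IH XS mulrC.
  by rewrite big_ord0 hX0// sqr_normc expr1n expr0n addr0.
have E n : ('E_P[(fun w => Normc.normc (X n w xi eta) ^+ 2)%R] = (m ^+ n)%:E)%E.
  rewrite -(expectation_iid_product _ _ _ _ _ _ hZ g m g0 mg
    (integral_normal_symbol _ c dd e r r0)).
  by congr expectation; apply/funext => w; rewrite Xprod.
(* [m] is the second moment after one step, so it is an expectation of a square. *)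
have m0 : 0 <= m.
  rewrite -lee_fin -(expr1 m) -E; apply: expectation_ge0 => w; exact: sqr_ge0.
have m1 : m < 1.
  rewrite /m /r mulrC ltr_pdivrMr// mul1r; apply: lt_le_trans A_ge.
  apply: le_lt_trans estimate; rewrite le_eqVlt; apply/orP; left; apply/eqP.
  (* The variance of [W]. After this substitution the numerator of [m] is exactly the left side of
     [estimate]. *)
  have -> : c ^+ 2 + dd ^+ 2 = s + 2 * rhoxy * p * q.
    rewrite /c /dd exprMn sqr_sqrtr; first by rewrite /s; ring.
    by rewrite subr_ge0 -real_normK ?num_real// exprn_ile1// ler_norml rN1.
  by rewrite /e -/s; rewrite /s; field.
under eq_fun do rewrite E.
apply: cvg_EFin; first exact: nearW.
by apply: cvg_expr; rewrite ger0_norm.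
Qed.
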